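(* Let $\varphi$ be an increasing concave function on $[0,\infty)$ such that $\lim_{t\to0^+}\varphi(t)=0$ and $q_\varphi<1$. Then the space $C(M_\varphi^0)$ on $[0,\infty)$ has the Dunford–Pettis property.
   Context: Convention: $\varphi(0)=0$, $\varphi>0$ on $(0,\infty)$. Marcinkiewicz space $M_\varphi$ on $[0,\infty)$: measurable $f$ with $\|f\|=\sup_{t>0}\frac{\varphi(t)}{t}\int_0^tf^*(s)\,ds<\infty$, $f^*$ the decreasing rearrangement. $M_\varphi^0$ is its subspace of elements with order continuous norm: $f$ such that $\|f\chi_{A_n}\|\to0$ for every decreasing sequence of measurable sets $A_n$ with $m(\bigcap A_n)=0$; it carries the norm of $M_\varphi$. With $Cf(x)=\frac1x\int_0^xf(t)\,dt$, $C(M_\varphi^0)=\{f:C|f|\in M_\varphi^0\}$, $\|f\|=\|C|f|\|_{M_\varphi}$. Index: $\overline\varphi(s)=\sup_{t>0}\varphi(st)/\varphi(t)$, $q_\varphi=\lim_{s\to\infty}\ln\overline\varphi(s)/\ln s$. Dunford–Pettis property: $x_n\to0$ weakly and $x_n^*\to0$ weakly in the dual imply $x_n^*(x_n)\to0$. *)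

(* Defs.v *)
From HB Require Import structures.
From mathcomp Require Import all_boot all_order all_algebra.
From mathcomp Require Import all_classical all_reals all_analysis.
Set Implicit Arguments. Unset Strict Implicit. Unset Printing Implicit Defensive.
Import Order.TTheory GRing.Theory Num.Theory.
Import numFieldNormedType.Exports.
Local Open Scope classical_set_scope.
Local Open Scope ring_scope.

Section MarcinkiewiczDefs.
Variable R : realType.
Local Notation mu := (@lebesgue_measure R).

(* the half line [0, oo) on which all functions live; values on (-oo,0) are ignored *)
Definition Dom : set R := [set x | 0 <= x].

Definition I0 (t : R) : set R := `[0, t]%classic.

Definition distrib (f : R -> R) (l : R) : \bar R :=
  mu (Dom `&` [set x | l < `|f x|]).

Definition rearr (f : R -> R) (s : R) : \bar R :=
  ereal_inf [set l%:E | l in [set l : R | 0 <= l /\ (distrib f l <= s%:E)%E]].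

Definition Mnorm (phi : R -> R) (f : R -> R) : \bar R :=
  ereal_sup [set ((phi t / t)%:E * \int[mu]_(s in I0 t) rearr f s)%E
            | t in [set t : R | 0 < t]].

Definition inM (phi : R -> R) (f : R -> R) : Prop :=
  measurable_fun Dom f /\ (Mnorm phi f < +oo)%E.

(* M_phi^0 : elements of M_phi with order continuous norm *)
Definition inM0 (phi : R -> R) (f : R -> R) : Prop :=
  inM phi f /\
  forall A : nat -> set R,
    (forall n, measurable (A n)) ->
    (forall n, A n.+1 `<=` A n) ->
    mu (\bigcap_n A n) = 0%E ->
    (fun n => Mnorm phi (fun x => f x * \1_(A n) x)) @ \oo --> 0%E.

Definition CesAbs (f : R -> R) (x : R) : R :=
  fine (\int[mu]_(t in I0 x) (`|f t|)%:E) / x.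

(* C(M_phi^0) = {f : C|f| in M_phi^0}; local integrability makes C|f| finite *)
Definition inCM0 (phi : R -> R) (f : R -> R) : Prop :=
  measurable_fun Dom f /\
  (forall x, 0 < x -> mu.-integrable (I0 x) (EFin \o f)) /\
  inM0 phi (CesAbs f).

Definition CMnorm (phi : R -> R) (f : R -> R) : R := fine (Mnorm phi (CesAbs f)).

Definition dualX (phi : R -> R) (xs : (R -> R) -> R) : Prop :=
  (forall (a : R) f g, inCM0 phi f -> inCM0 phi g ->
      xs (fun x => a * f x + g x) = a * xs f + xs g) /\
  exists K : R, forall f, inCM0 phi f -> `|xs f| <= K * CMnorm phi f.

Definition dualnorm (phi : R -> R) (xs : (R -> R) -> R) : \bar R :=
  ereal_sup [set (`|xs f|)%:E | f in [set f | inCM0 phi f /\ CMnorm phi f <= 1]].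

Definition bidualX (phi : R -> R) (Phi : ((R -> R) -> R) -> R) : Prop :=
  (forall (a : R) xs ys, dualX phi xs -> dualX phi ys ->
      Phi (fun f => a * xs f + ys f) = a * Phi xs + Phi ys) /\
  exists K : R, forall xs, dualX phi xs ->
      ((`|Phi xs|)%:E <= K%:E * dualnorm phi xs)%E.

Definition weak0X (phi : R -> R) (u : nat -> R -> R) : Prop :=
  (forall n, inCM0 phi (u n)) /\
  forall xs, dualX phi xs -> (fun n => xs (u n)) @ \oo --> 0.

Definition weak0dual (phi : R -> R) (v : nat -> (R -> R) -> R) : Prop :=
  (forall n, dualX phi (v n)) /\
  forall Phi, bidualX phi Phi -> (fun n => Phi (v n)) @ \oo --> 0.

Definition DunfordPettis_CM0 (phi : R -> R) : Prop :=
  forall (u : nat -> R -> R) (v : nat -> (R -> R) -> R),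
    weak0X phi u -> weak0dual phi v -> (fun n => v n (u n)) @ \oo --> 0.

Definition phibar (phi : R -> R) (s : R) : R :=
  fine (ereal_sup [set (phi (s * t) / phi t)%:E | t in [set t : R | 0 < t]]).

Definition upper_index_lt1 (phi : R -> R) : Prop :=
  exists q : R, q < 1 /\
    (fun s => ln (phibar phi s) / ln s) x @[x --> +oo] --> q.

End MarcinkiewiczDefs.

(* Main.v *)
Require Import Defs.
From HB Require Import structures.
From mathcomp Require Import all_boot all_order all_algebra.
From mathcomp Require Import all_classical all_reals all_analysis.
From mathcomp Require Import measurable_realfun ring lra.
Set Implicit Arguments. Unset Strict Implicit. Unset Printing Implicit Defensive.
Import Order.TTheory GRing.Theory Num.Theory.
Import numFieldNormedType.Exports.
Local Open Scope classical_set_scope.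
Local Open Scope ring_scope.

(* With S f t = \int_0^t |f|, the index condition provides a > 1 and r < 1 with
   phi (a t) <= r a phi t, whence \int_0^t 1/phi = O(t / phi t). Consequently the
   norm of C(M_phi^0) is equivalent to sup_t phi(t) S f t / t, the membership
   condition says that this quotient vanishes at 0 and at infinity, and the space
   behaves like a c_0-sum of L^1 spaces over the intervals [a^k, a^(k+1)].

   Let u_n and v_n be weakly null in the space and in its dual. A sliding hump
   (Schur) argument shows that a weakly null sequence tends to 0 uniformly along
   the terms of every weakly unconditionally Cauchy series of functionals. This
   one principle gives: boundedness of u_n and v_n; uniform smallness of the v_n
   outside a band [1/M, M], by testing on well separated blocks; and
   equi-integrability of the u_n on the band. On the band v_n is given by a
   bounded density, whose superlevel sets are found by Hahn decomposition, and
   the densities tend to 0 a.e. by an ultrafilter construction of elements of the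
   bidual. As in Egorov's theorem, v_n (u_n) is then small off a set on which all
   the u_n are uniformly integrable. *)

(** Neither the dual nor the bidual is represented concretely. A functional enters only through an
    estimate [|v f| <= K * P], valid whenever P bounds phi(t) S f t / t for all t, and on a band
    through the set function A -> v(1_A). Subtracting e times Lebesgue measure and taking Hahn sets
    replaces the comparison of a density with the level e.

    The Schur principle needs estimates sum_j |h_j f| <= K ||f||: they make every subseries of the
    h_j a bounded functional, to which weak convergence applies. These estimates have three sources:
    geometric coefficients (boundedness), integrals over disjoint subsets of one interval (the L^1
    direction), and choices of signs on separated blocks (the c_0 direction).

    The index condition says that t / phi t shrinks at least by the factor r when t is replaced by t
    / a. A bound on each window ]t/a, t] therefore yields a bound on [0, t] at the price of a factor
    1/(1-r), and blocks a factor a apart are never seen by the same window. *)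

(** Dependent choice in which a new term may depend on the whole list of its predecessors, as
    gliding hump constructions require. *)
Lemma seq_choice (T : Type) (P : seq T -> T -> Prop) :
  (forall l, exists y, P l y) ->
  exists z : nat -> T, forall k, P (mkseq z k) (z k).
Proof.
move=> /choice[f fP].
pose L := fix L k := if k is k'.+1 then rcons (L k') (f (L k')) else [::].
exists (fun k => f (L k)) => k; suff -> : mkseq (fun k => f (L k)) k = L k by [].
by elim: k => //= k IH; rewrite mkseqS IH.
Qed.

Lemma eventually_bounded_forall (k : nat) (Q : nat -> nat -> Prop) :
  (forall m, (m < k)%N -> exists N, forall i, (N <= i)%N -> Q m i) ->
  exists N, forall i, (N <= i)%N -> forall m, (m < k)%N -> Q m i.
Proof.
elim: k => [|k IH] H; first by exists 0%N.
have [N HN] := IH (fun m mk => H m (ltnW mk)).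
have [N' HN'] := H k (ltnSn k).
exists (maxn N N') => i; rewrite geq_max => /andP[Ni N'i] m.
rewrite ltnS leq_eqVlt => /predU1P[->|mk]; [exact: HN'|exact: HN].
Qed.

(** * Schur's principle for double sequences *)

Section Schur.
Variable R : realType.
Implicit Types (e : R).

Lemma cvg0_eventually (u : nat -> R) : u @ \oo --> 0 ->
  forall e, 0 < e -> exists N, forall i, (N <= i)%N -> `|u i| <= e.
Proof.
move=> u0 e e0; have /cvgrPdist_le/(_ e e0)[N _ HN] := u0.
by exists N => i Ni; have := HN i Ni; rewrite /= sub0r normrN.
Qed.

Lemma eventually_cvg0 (u : nat -> R) :
  (forall e, 0 < e -> exists N, forall i, (N <= i)%N -> `|u i| <= e) ->
  u @ \oo --> 0.
Proof.
move=> H; apply/cvgrPdist_le => e e0; have [N HN] := H e e0.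
by exists N => // i /= Ni; rewrite sub0r normrN; exact: HN.
Qed.

Lemma sum_geometric_half (n : nat) (e : R) : 0 <= e ->
  \sum_(l < n) (e / 2 ^+ l.+2) <= e / 2.
Proof.
move=> e0; suff -> : \sum_(l < n) (e / 2 ^+ l.+2) = e / 2 - e / 2 ^+ n.+1.
  by rewrite gerBl divr_ge0// exprn_ge0.
elim: n => [|n IH]; first by rewrite big_ord0 expr1 subrr.
rewrite big_ord_recr/= IH !exprS; have : (2 ^+ n : R) != 0 by rewrite expf_neq0.
by move=> ?; field.
Qed.

(* Sliding hump: a failure of uniformity yields rows i_k and columns j_k with
   |x (i_k) (j_k)| > e while the other entries x (i_k) (j_l) are summably small,
   so the subseries over the columns j_l does not tend to 0 along i_k. *)
Lemma subseries_cvg0_uniform (x : nat -> nat -> R) :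
  (forall th : nat -> bool, exists2 s : nat -> R, s @ \oo --> 0 &
     forall i, (fun n => \sum_(j < n) (th j)%:R * x i j) @ \oo --> s i) ->
  forall e, 0 < e -> exists J, forall i j, (J <= j)%N -> `|x i j| <= e.
Proof.
move=> H e e0; apply/not_existsP => nJ.
have {}nJ J : exists ij : nat * nat, (J <= ij.2)%N /\ e < `|x ij.1 ij.2|.
  apply: contra_notP (nJ J) => /forallNP nij i j Jj; rewrite leNgt.
  by apply/negP => xij; apply: (nij (i, j)).
(* Taking all columns, [th] constantly true, gives convergent series along each row, whose terms
   tend to 0. *)
have rows i d : 0 < d -> exists N, forall j, (N <= j)%N -> `|x i j| <= d.
  move=> d0; have [s _ /(_ i) Hs] := H (fun=> true).
  apply: cvg0_eventually d d0.
  apply: cvg_series_cvg_0; apply/cvg_ex; exists (s i).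
  rewrite /series/=; apply: cvg_trans Hs; apply: near_eq_cvg.
  by apply: nearW => n; rewrite big_mkord; apply: eq_bigr => k _; rewrite mul1r.
(* With [th] the indicator of the single index j, the sums converge to the column j itself. *)
have cols j d : 0 < d -> exists N, forall i, (N <= i)%N -> `|x i j| <= d.
  move=> d0; have [s s0 Hs] := H (fun k => k == j).
  apply: cvg0_eventually d d0; suff -> : x^~ j = s by [].
  apply/funext => i; rewrite -(cvg_lim _ (Hs i))//.
  apply/esym/cvg_lim => //; apply: cvg_near_cst.
  exists j.+1 => // n /= jn; rewrite (bigD1 (Ordinal jn))//= eqxx mul1r big1 ?addr0//.
  by move=> k; rewrite -val_eqE/= => /negbTE ->; rewrite mul0r.
(* In both inequalities the column fixes the allowance: the m-th chosen column costs at most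
   [e / 2 ^+ m.+2] in every other chosen row, earlier or later. These costs add up to at most e /
   2. *)
pose P l (ij : nat * nat) := e < `|x ij.1 ij.2| /\
  forall m, (m < size l)%N -> let q := nth (0%N, 0%N) l m in
    [/\ (q.2 < ij.2)%N, (q.1 < ij.1)%N, `|x ij.1 q.2| <= e / 2 ^+ m.+2 &
        `|x q.1 ij.2| <= e / 2 ^+ (size l).+2].
have [l|z zP] := @seq_choice _ P.
  pose q m := nth (0%N, 0%N) l m.
  have ep m : 0 < e / 2 ^+ m.+2 by rewrite divr_gt0// exprn_gt0.
  have [I HI] : exists I, forall i, (I <= i)%N -> forall m, (m < size l)%N ->
      ((q m).1 < i)%N /\ `|x i (q m).2| <= e / 2 ^+ m.+2.
    apply: eventually_bounded_forall => m _.
    have [N HN] := cols (q m).2 _ (ep m).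
    by exists (maxn N (q m).1.+1) => i; rewrite geq_max => /andP[/HN].
  have [J HJ] : exists J, forall j, (J <= j)%N -> forall m, (m < size l)%N ->
      ((q m).2 < j)%N /\ `|x (q m).1 j| <= e / 2 ^+ (size l).+2.
    apply: eventually_bounded_forall => m _.
    have [N HN] := rows (q m).1 _ (ep (size l)).
    by exists (maxn N (q m).2.+1) => j; rewrite geq_max => /andP[/HN].
  (* Beyond column J' the rows below I have no entry larger than e, so a large entry found there
     lies in a row at least I. *)
  have [J' HJ'] : exists J', forall j, (J' <= j)%N -> forall i, (i < I)%N ->
      `|x i j| <= e.
    by apply: eventually_bounded_forall => i _; exact: rows.
  have [[i j]/= [Jj xij]] := nJ (maxn J J').
  move: Jj; rewrite geq_max => /andP[Jj J'j].
  have Ii : (I <= i)%N.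
    by rewrite leqNgt; apply/negP => iI; have := HJ' _ J'j _ iI; rewrite leNgt xij.
  exists (i, j); split => //= m ml.
  by have [] := HI _ Ii _ ml; have [] := HJ _ Jj _ ml.
have zlt k m : (m < k)%N -> [/\ ((z m).2 < (z k).2)%N, ((z m).1 < (z k).1)%N,
    `|x (z k).1 (z m).2| <= e / 2 ^+ m.+2 &
    `|x (z m).1 (z k).2| <= e / 2 ^+ k.+2].
  by move=> mk; have [_] := zP k; rewrite size_mkseq => /(_ m mk); rewrite nth_mkseq.
have off k l : k != l -> `|x (z k).1 (z l).2| <= e / 2 ^+ l.+2.
  by rewrite neq_ltn => /orP[]/zlt[].
pose th j := `[< exists l, (z l).2 = j >].
have [s s0 Hs] := H th.
(* The chosen columns increase strictly, so cutting the series just before column [(z L).2] leaves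
   exactly the first L of them. *)
have zsum i L : \sum_(j < (z L).2) (th j)%:R * x i j = \sum_(l < L) x i (z l).2.
  have th0 lo L' j : (lo < j)%N -> (j < (z L')%N.2)%N ->
      (forall l, (l < L')%N -> ((z l).2 <= lo)%N) -> th j = false.
    move=> loj jL Hl; apply/negbTE/asboolPn => -[l lj].
    have [lL|Ll] := ltnP l L'; first by have := Hl _ lL; rewrite lj leqNgt loj.
    move: Ll; rewrite leq_eqVlt => /predU1P[E|/zlt[+ _ _ _]].
      by move: jL; rewrite E lj ltnn.
    by rewrite lj ltnNge (ltnW jL).
  elim: L => [|L IH].
    rewrite big_ord0 big1// => j _.
    suff -> : th j = false by rewrite mul0r.
    apply/negbTE/asboolPn => -[l lj]; have : ((z 0%N).2 <= (z l).2)%N.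
      by case: l lj => // l _; have /ltnW := let: And4 h _ _ _ := zlt l.+1 0%N isT in h.
    by rewrite lj leqNgt ltn_ord.
  have [zLL _ _ _] := zlt L.+1 L (ltnSn L).
  rewrite big_ord_recr/= -IH -2!(big_mkord xpredT (fun j => (th j)%:R * x i j)).
  rewrite (@big_cat_nat _ _ _ (z L).2)//=; last exact: ltnW.
  congr (_ + _); rewrite big_ltn// big_nat_cond big1 ?addr0.
    suff -> : th (z L).2 = true by rewrite mul1r.
    by apply/asboolP; exists L.
  move=> j; rewrite andbT => /andP[Lj jL].
  rewrite (th0 (z L).2 L.+1 j)// ?mul0r// => l; rewrite ltnS leq_eqVlt.
  by move=> /predU1P[->//|/zlt[/ltnW]].
have zge k : (k <= (z k).1)%N /\ (k <= (z k).2)%N.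
  elim: k => // k [IH1 IH2]; have [h2 h1 _ _] := zlt k.+1 k (ltnSn k).
  by split; [exact: leq_ltn_trans h1|exact: leq_ltn_trans h2].
(* The diagonal entry exceeds e and the remaining entries of the row sum to at most e / 2. *)
have sbig k : e / 2 <= `|s (z k).1|.
  have cs : (fun L => `|\sum_(l < L) x (z k).1 (z l).2|) @ \oo --> `|s (z k).1|.
    apply: cvg_norm; under eq_fun do rewrite -zsum.
    apply: (cvg_comp _ _ _ (Hs (z k).1)).
    by apply/cvgnyPge => A; exists A => // n /= An; have [_ ?] := zge n; exact: leq_trans An _.
  rewrite -(cvg_lim _ cs)//; apply: limr_ge; first by apply/cvg_ex; eexists; exact: cs.
  exists k.+1 => // L /= kL.
  rewrite (bigD1 (Ordinal kL))//=.
  have [xk _] := zP k.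
  apply: le_trans (lerB_normD _ _); rewrite lerBrDr.
  apply: le_trans (ltW xk); rewrite -lerBrDl {1}[e in e - _]splitr addrK.
  apply: le_trans (ler_norm_sum _ _ _) _.
  apply: le_trans (sum_geometric_half L (ltW e0)).
  rewrite [leRHS](bigID (fun i : 'I_L => i != Ordinal kL))/=.
  rewrite -[leLHS]addr0; apply: lerD.
    by apply: ler_sum => l; rewrite -val_eqE/= eq_sym => /off.
  by apply: sumr_ge0 => l _; rewrite divr_ge0 ?exprn_ge0// ltW.
have [|N HN] := cvg0_eventually s0 (e := e / 4); first by rewrite divr_gt0.
have [h _] := zge N; have := HN _ h; have := sbig N; lra.
Qed.

End Schur.

(** * Weakly unconditionally Cauchy series of functionals *)

Section WeaklyUnconditionallyCauchy.
Variables (R : realType) (T : Type) (comb : R -> T -> T -> T).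
Variables (D : T -> Prop) (N : T -> R).

(** [comb a f g] stands for a f + g. With the operation, the domain [D] and the seminorm [N]
    abstract, the same principle serves the function space and its dual, neither of which is
    packaged as a normed space. *)
Definition linear_on (F : T -> R) :=
  forall a f g, D f -> D g -> F (comb a f g) = a * F f + F g.

Lemma wuC_cvg_subseries (h : nat -> T -> R) (K : R) (th : nat -> bool) f :
  (forall n, \sum_(j < n) `|h j f| <= K * N f) ->
  cvgn (fun n => \sum_(j < n) (th j)%:R * h j f).
Proof.
move=> hK; have -> : (fun n => \sum_(j < n) (th j)%:R * h j f) =
    series (fun j => (th j)%:R * h j f).
  by apply/funext => n; rewrite /series/= big_mkord.
apply: normed_cvg; apply: nondecreasing_is_cvgn.
  apply/nondecreasing_seqP => n.
  change (\sum_(0 <= j < n) `|(th j)%:R * h j f| <=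
          \sum_(0 <= j < n.+1) `|(th j)%:R * h j f|).
  by rewrite big_nat_recr//= lerDl.
exists (K * N f) => _ [n _ <-]; apply: le_trans (hK n).
change (\sum_(0 <= j < n) `|(th j)%:R * h j f| <= \sum_(j < n) `|h j f|).
rewrite big_mkord; apply: ler_sum => j _.
by case: (th j); rewrite ?mul1r// mul0r normr0.
Qed.

(** For every choice of indices [th], the sum of the h_j with [th j] true is again a linear
    functional bounded by K, hence tends to 0 along x. This is the hypothesis of
    [subseries_cvg0_uniform] for the double sequence h_j (x_i). *)
Lemma wuC_uniform (x : nat -> T) (h : nat -> T -> R) (K : R) :
  (forall n, D (x n)) ->
  (forall F, linear_on F -> (exists K, forall f, D f -> `|F f| <= K * N f) ->
     (fun n => F (x n)) @ \oo --> 0) ->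
  (forall j, linear_on (h j)) ->
  (forall f n, D f -> \sum_(j < n) `|h j f| <= K * N f) ->
  forall e, 0 < e -> exists J, forall i j, (J <= j)%N -> `|h j (x i)| <= e.
Proof.
move=> Dx x0 hlin hK; apply: subseries_cvg0_uniform => th.
pose P f n := \sum_(j < n) (th j)%:R * h j f.
have cP f : D f -> P f @ \oo --> limn (P f).
  by move=> Df; apply: wuC_cvg_subseries => n; exact: hK.
exists (fun n => limn (P (x n))); last by move=> i; exact: cP.
apply: (x0 (fun f => limn (P f))).
  move=> a f g Df Dg; apply/cvg_lim => //.
  have -> : P (comb a f g) = (fun n => a * P f n + P g n).
    apply/funext => n; rewrite /P mulr_sumr -big_split/=; apply: eq_bigr => j _.
    by rewrite hlin//; ring.
  apply: cvgD; last exact: cP.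
  by apply: cvgMr; exact: cP.
exists K => f Df; have cn : (fun n => `|P f n|) @ \oo --> `|limn (P f)|.
  by apply: cvg_norm; exact: cP.
rewrite -(cvg_lim _ cn)//; apply: limr_le.
  by apply/cvg_ex; eexists; exact: cn.
apply: nearW => n; apply: le_trans (ler_norm_sum _ _ _) _.
apply: le_trans (hK f n Df); apply: ler_sum => j _.
by case: (th j); rewrite ?mul1r// mul0r normr0.
Qed.

End WeaklyUnconditionallyCauchy.

(** * The weight: concavity and the index condition in quantitative form *)

(** The form in which the hypotheses on phi are used. [weight_ratio] is the trace of concavity, and
    [weight_dilation] is the index condition read at one single scale a, with dilation factor
    strictly below a. *)
Record weight (R : realType) (phi : R -> R) (a r : R) : Prop := {
  weight_gt0 : forall t : R, 0 < t -> 0 < phi t ;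
  weight_le : forall s t : R, 0 < s -> s <= t -> phi s <= phi t ;
  weight_ratio : forall s t : R, 0 < s -> s <= t -> phi t / t <= phi s / s ;
  weight_at0 : forall e : R, 0 < e -> exists2 d : R, 0 < d &
    forall t : R, 0 < t -> t < d -> phi t <= e ;
  weight_a1 : 1 < a ;
  weight_r0 : 0 < r ;
  weight_r1 : r < 1 ;
  weight_dilation : forall t : R, 0 < t -> phi (a * t) <= r * a * phi t }.

Section WeightExists.
Variables (R : realType) (phi : R -> R).
Hypothesis phi00 : phi 0 = 0.
Hypothesis phi_gt0 : forall t : R, 0 < t -> 0 < phi t.
Hypothesis phi_homo : {in (@Dom R) &, {homo phi : x y / x <= y}}.
Hypothesis phi_concave : forall x y (l : R), 0 <= x -> 0 <= y -> 0 <= l <= 1 ->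
  (1 - l) * phi x + l * phi y <= phi ((1 - l) * x + l * y).
Hypothesis phi_cvg0 : phi x @[x --> 0^'+] --> 0.
Hypothesis phi_index : upper_index_lt1 phi.

(** Concavity on the segment from 0 to t, at the point s. *)
Let ratio s t : 0 < s -> s <= t -> phi t / t <= phi s / s.
Proof.
move=> s0 st; have t0 := lt_le_trans s0 st.
have st1 : 0 <= s / t <= 1 by rewrite divr_ge0 ?(ltW s0) ?(ltW t0)//= ler_pdivrMr// mul1r.
have := phi_concave (lexx 0) (ltW t0) st1.
rewrite phi00 !mulr0 !add0r divfK ?gt_eqF// => h.
by rewrite ler_pdivlMr//; apply: le_trans h; rewrite le_eqVlt; apply/orP; left; apply/eqP; ring.
Qed.

(** The supremum inside [phibar] is at most s by concavity, so [fine] returns its true value and not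
    the default 0. *)
Let phibar_fin s : 1 <= s -> forall t : R, 0 < t -> phi (s * t) / phi t <= phibar phi s.
Proof.
move=> s1 t t0; rewrite /phibar.
set A := [set _ | _ in _].
have ub : (ereal_sup A <= s%:E)%E.
  apply: ge_ereal_sup => _ [u /= u0 <-]; rewrite lee_fin ler_pdivrMr ?phi_gt0//.
  have su0 : 0 < s * u by rewrite mulr_gt0// (lt_le_trans ltr01).
  have := @ratio u (s * u) u0; rewrite ler_peMl ?(ltW u0)// => /(_ isT).
  rewrite ler_pdivrMr// => /le_trans; apply.
  rewrite le_eqVlt; apply/orP; left; apply/eqP; field; exact: lt0r_neq0.
have lb u : 0 < u -> ((phi (s * u) / phi u)%:E <= ereal_sup A)%E.
  by move=> u0; apply: ereal_sup_ubound; exists u.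
rewrite -lee_fin fineK; first exact: lb.
rewrite fin_numE; apply/andP; split.
  by apply/eqP => h; have := lb t t0; rewrite h.
by apply/eqP => h; move: ub; rewrite h.
Qed.

(** For large a the index gives ln(phibar a) / ln a < (q + 1) / 2 < 1, that is phibar a < a; then r
    is phibar a / a. *)
Lemma weight_exists : exists a r, weight phi a r.
Proof.
have [q [q1 hq]] := phi_index.
have : \forall s \near +oo, ln (phibar phi s) / ln s < (q + 1) / 2.
  by apply: (cvgr_lt q) => //; lra.
move=> h; have [M [_ HM]] := h.
(* The first entry puts a in the range where the index estimate holds, the second makes ln a
   positive. *)
pose a := Num.max (M + 1) 2.
have Ma : M < a by rewrite lt_max; apply/orP; left; lra.
have a1 : 1 < a by rewrite lt_max; apply/orP; right; lra.
have a0 : 0 < a by lra.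
have lna : 0 < ln a by rewrite ln_gt0.
have b0 : 0 < phibar phi a.
  have := phibar_fin (ltW a1) ltr01; apply: lt_le_trans.
  by rewrite divr_gt0 ?phi_gt0// mulr1.
have ba : phibar phi a < a.
  have := HM a Ma; rewrite /= ltr_pdivrMr// => hl.
  rewrite -ltr_ln ?posrE//; apply: (lt_trans hl).
  by rewrite gtr_pMl//; lra.
exists a, (phibar phi a / a); split => //.
- move=> s t s0 st; apply: phi_homo => //; rewrite inE /Dom/=; first exact: ltW.
  by apply: le_trans st; exact: ltW.
- move=> e e0; have /cvgrPdist_le/(_ e e0) := phi_cvg0.
  move=> [d /= d0 Hd]; exists d => // t t0 td.
  have := Hd t; rewrite /= sub0r normrN gtr0_norm// => /(_ td t0).
  by rewrite sub0r normrN; apply: le_trans; exact: ler_norm.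
- by rewrite divr_gt0.
- by rewrite ltr_pdivrMr// mul1r.
- move=> t t0; rewrite divfK ?gt_eqF//.
  by rewrite -ler_pdivrMr ?phi_gt0//; exact: (phibar_fin (ltW a1)).
Qed.

End WeightExists.

(** * Geometric decay and the Hardy-type integral estimate *)

Section WeightTheory.
Variables (R : realType) (phi : R -> R) (a r : R).
Hypothesis W : weight phi a r.
Local Notation mu := (@lebesgue_measure R).

Let phi_gt0 := weight_gt0 W.
Let a1 := weight_a1 W.
Let r0 := weight_r0 W.
Let r1 := weight_r1 W.
Let a0 : 0 < a. Proof. exact: lt_trans ltr01 a1. Qed.

Lemma weight_contraction t : 0 < t -> (t / a) / phi (t / a) <= r * (t / phi t).
Proof.
move=> t0; have ta0 : 0 < t / a by rewrite divr_gt0.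
rewrite ler_pdivrMr ?phi_gt0// mulrA mulrAC ler_pdivlMr ?phi_gt0//.
have := weight_dilation W ta0; rewrite mulrCA mulfV ?gt_eqF// mulr1 => h.
rewrite -(ler_pM2l a0) !mulrA (mulrC a t) mulfK ?gt_eqF//.
have -> : a * r * t * phi (t / a) = t * (r * a * phi (t / a)) by ring.
by rewrite ler_pM2l.
Qed.

(** The left side dominates the integral of 1 / phi over the window ]t/a, t]: length at most t,
    integrand at most 1 / phi(t/a). *)
Lemma weight_inv_le t : 0 < t -> t / phi (t / a) <= r * a * (t / phi t).
Proof.
move=> t0; have := weight_contraction t0.
rewrite -(ler_pM2l a0); have -> : a * (t / a / phi (t / a)) = t / phi (t / a).
  by field; rewrite !gt_eqF// phi_gt0// divr_gt0.
by move=> /le_trans; apply; rewrite mulrCA mulrA.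
Qed.

(** By contraction the k-th step costs at most D r^k t / phi t, and the geometric series sums to the
    factor 1 / (1 - r). It serves both for integrals of 1 / phi and for primitives of functions. *)
Lemma weight_recursion (G : R -> R) (D : R) : 0 <= D ->
  (forall t : R, 0 < t -> G t <= G (t / a) + D * (t / phi t)) ->
  forall n t, 0 < t -> G t <= G (t / a ^+ n) + D / (1 - r) * (t / phi t).
Proof.
move=> D0 HG; have r1' : 0 < 1 - r by rewrite subr_gt0.
elim=> [|n IH] t t0.
  rewrite expr0 divr1 lerDl mulr_ge0 ?divr_ge0 ?(ltW t0) ?(ltW r1')//.
  exact: ltW (phi_gt0 t0).
apply: le_trans (HG t t0) _.
have ta0 : 0 < t / a by rewrite divr_gt0.
have := IH _ ta0; rewrite -mulrA -invfM -exprS => h.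
have hc := weight_contraction t0.
have : D / (1 - r) * (t / a / phi (t / a)) <= D / (1 - r) * (r * (t / phi t)).
  by rewrite ler_wpM2l// divr_ge0// ltW.
have -> : D / (1 - r) * (t / phi t) =
    D / (1 - r) * (r * (t / phi t)) + D * (t / phi t).
  by field; rewrite !gt_eqF// phi_gt0.
lra.
Qed.

Lemma exists_expr_lt (q e : R) : 0 <= q -> q < 1 -> 0 < e -> exists n, q ^+ n < e.
Proof.
move=> q0 q1 e0; have : (fun n => q ^+ n) @ \oo --> 0.
  by apply: cvg_expr; rewrite ger0_norm.
move=> /cvgr_lt/(_ e e0)[n _ Hn]; exists n; exact: (Hn n (leqnn n)).
Qed.

(** Along the powers of a the quotient decays like r^n; monotonicity of phi t / t fills the gaps. *)
Lemma weight_at_infty e : 0 < e -> exists2 T : R, 0 < T &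
  forall t, T <= t -> phi t / t <= e.
Proof.
move=> e0; have p1 := phi_gt0 ltr01.
have [|n Hn] := exists_expr_lt (ltW r0) r1 (e := e / phi 1).
  by rewrite divr_gt0.
have an0 m : 0 < a ^+ m by rewrite exprn_gt0.
have H m : phi (a ^+ m) / a ^+ m <= r ^+ m * phi 1.
  elim: m => [|m IH]; first by rewrite !expr0 divr1 mul1r.
  have := weight_dilation W (an0 m); rewrite -exprS => h.
  rewrite ler_pdivrMr//; apply: (le_trans h).
  rewrite ler_pdivrMr// in IH.
  rewrite !exprS; have -> : r * r ^+ m * phi 1 * (a * a ^+ m) =
    r * a * (r ^+ m * phi 1 * a ^+ m) by ring.
  by rewrite ler_pM2l// mulr_gt0.
exists (a ^+ n) => // t nt; apply: le_trans (weight_ratio W (an0 n) nt) _.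
apply: le_trans (H n) _; move: Hn; rewrite ltr_pdivlMr//; exact: ltW.
Qed.

Lemma nonincreasing_emeasurable (w : R -> \bar R) :
  {homo w : x y / x <= y >-> (y <= x)%E} -> measurable_fun [set: R] w.
Proof.
move=> wd _; apply: (measurability _ (ErealGenCInfty.measurableE R)) => //.
move=> _ [_ [x ->] <-]; apply: measurableI => //.
apply: is_interval_measurable => s t /=; rewrite !in_itv/= !andbT => ws wt u.
by move=> /andP[_ ut]; rewrite in_itv/= andbT; apply: le_trans wt _; exact: wd.
Qed.

Lemma integral_le_cst (w : R -> \bar R) (A : set R) (c : R) : measurable A ->
  measurable_fun [set: R] w -> (forall s, A s -> 0 <= w s <= c%:E)%E ->
  (\int[mu]_(s in A) w s <= c%:E * mu A)%E.
Proof.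
move=> mA mw wc; rewrite -integral_cst//; apply: ge0_le_integral => //.
- by move=> x /wc/andP[].
- exact: measurable_funTS.
- by move=> x /wc/andP[].
Qed.

(** Away from 0 the integral is finite and satisfies the recursion over windows with a constant
    independent of the cut-off tau; monotone convergence then removes tau. *)
Lemma integral_le_weight (w : R -> \bar R) (P : R) : 0 <= P ->
  measurable_fun [set: R] w ->
  (forall s : R, 0 < s -> (0 <= w s <= (P / phi s)%:E)%E) ->
  forall t : R, 0 < t ->
  (\int[mu]_(s in I0 t) w s <= (P * (r * a) / (1 - r) * (t / phi t))%:E)%E.
Proof.
move=> P0 mw wP t t0; set B := (X in (_ <= X%:E)%E).
have B0 : 0 <= B.
  rewrite /B !mulr_ge0 ?invr_ge0 ?subr_ge0 ?(ltW r0) ?(ltW a0) ?(ltW t0) ?(ltW r1)//.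
  exact: ltW (phi_gt0 t0).
have key tau : 0 < tau -> (\int[mu]_(s in `]tau, t]) w s <= B%:E)%E.
  move=> tau0; pose E (u : R) := (\int[mu]_(s in `]tau, u]) w s)%E.
  have E0 u : (0 <= E u)%E.
    apply: integral_ge0 => s /=; rewrite in_itv/= => /andP[ts _].
    by have /andP[] := wP s (lt_trans tau0 ts).
  have Efin u : E u \is a fin_num.
    rewrite ge0_fin_numE//; apply: (@le_lt_trans _ _ ((P / phi tau)%:E * mu (`]tau, u]%classic))%E).
      apply: integral_le_cst => // s /=; rewrite in_itv/= => /andP[ts _].
      have s0 := lt_trans tau0 ts; have /andP[-> /le_trans] := wP s s0; apply.
      rewrite lee_fin ler_wpM2l// lef_pV2 ?posrE ?phi_gt0//.
      exact: weight_le W _ _ tau0 (ltW ts).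
    rewrite lebesgue_measure_itv/= lte_fin; case: ifPn => _; first by rewrite -EFinB -EFinM ltry.
    by rewrite mule0.
  have rec u : 0 < u -> fine (E u) <= fine (E (u / a)) + P * (r * a) * (u / phi u).
    move=> u0; set b := u / a; have ua0 : 0 < b by rewrite divr_gt0.
    rewrite -lee_fin EFinD !fineK//.
    apply: (@le_trans _ _ (E (b) + \int[mu]_(s in `]b, u] `\` `]tau, b]) w s)%E).
      rewrite /E -ge0_integral_setU//.
      - apply: ge0_subset_integral => //.
        + by apply: measurableU => //; apply: measurableD.
        + exact: measurable_funTS.
        + move=> s [|[]]; rewrite /= in_itv/= => /andP[h _].
            by have /andP[] := wP s (lt_trans tau0 h).
          by have /andP[] := wP s (lt_trans ua0 h).
        + move=> s /=; rewrite in_itv/= => /andP[ts su].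
          have [h|h] := leP s b; first by left; rewrite /= in_itv/= ts h.
          by right; split; rewrite /= in_itv/= ?h// ts/= leNgt h.
      - exact: measurableD.
      - exact: measurable_funTS.
      - move=> s [|[]]; rewrite /= in_itv/= => /andP[h _].
          by have /andP[] := wP s (lt_trans tau0 h).
        by have /andP[] := wP s (lt_trans ua0 h).
      - by apply/disj_setPS => s [h1 [_ h2]].
    rewrite leeD2l//.
    apply: (@le_trans _ _ ((P / phi (b))%:E * mu (`]b, u]%classic `\` `]tau, (b)]))%E).
      apply: integral_le_cst => //; first exact: measurableD.
      move=> s [/=]; rewrite in_itv/= => /andP[us _] _.
      have s0 := lt_trans ua0 us; have /andP[-> /le_trans] := wP s s0; apply.
      rewrite lee_fin ler_wpM2l// lef_pV2 ?posrE ?phi_gt0//.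
      exact: weight_le W _ _ ua0 (ltW us).
    have mle : (mu (`]b, u]%classic `\` `]tau, (b)]) <= u%:E)%E.
      apply: (@le_trans _ _ (mu (`]b, u]%classic))).
        apply: le_measure; rewrite ?inE//; first exact: measurableD.
      rewrite lebesgue_measure_itv/= lte_fin; case: ifPn => _; last by rewrite lee_fin ltW.
      by rewrite -EFinB lee_fin gerBl ltW.
    apply: (@le_trans _ _ ((P / phi (b))%:E * u%:E)%E).
      by apply: lee_wpmul2l => //; rewrite lee_fin divr_ge0// ltW// phi_gt0.
    rewrite -EFinM lee_fin -!mulrA ler_wpM2l// mulrC [leRHS]mulrA.
    exact: weight_inv_le.
  (* After n steps the interval from tau to t / a^n is empty, so the recursion leaves no
     remainder. *)
  have [n Hn] : exists n, t / a ^+ n < tau.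
    have ai0 : 0 <= a^-1 by rewrite invr_ge0 ltW.
    have ai1 : a^-1 < 1 by rewrite invf_lt1.
    have [n Hn] := exists_expr_lt ai0 ai1 (divr_gt0 tau0 t0).
    by exists n; move: Hn; rewrite exprVn ltr_pdivlMr// mulrC.
  have PP : 0 <= P * (r * a) by rewrite !mulr_ge0 ?(ltW r0) ?(ltW a0).
  have := weight_recursion PP rec n t0.
  have -> : E (t / a ^+ n) = 0%E.
    by rewrite /E set_itv_ge ?integral_set0//= bnd_simp -leNgt ltW.
  by rewrite add0r => h; rewrite -[leLHS]fineK ?Efin// lee_fin.
(* The bound on w is available for s > 0 only: the point 0 is dropped and ]0, t] is exhausted by the
   intervals ]1/(n+1), t]. *)
rewrite -integral_itv_obnd_cbnd; last exact: measurable_funTS.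
have -> : `]0, t]%classic = \bigcup_n `]n.+1%:R^-1, t]%classic.
  apply/seteqP; split => [s /=|s [n _] /=]; rewrite !in_itv/= => /andP[h st].
    have [n Hn] := @ltr_add_invr R 0 s h; exists n => //=.
    by rewrite in_itv/= st andbT -[X in X < _]add0r.
  by rewrite st andbT (lt_trans _ h)// invr_gt0.
pose F n : set R := `]n.+1%:R^-1, t]%classic.
have Fnd : nondecreasing_seq F.
  apply/nondecreasing_seqP => n; apply/subsetPset => s; rewrite /F /=.
  rewrite !in_itv/= => /andP[h ->]; rewrite andbT (le_lt_trans _ h)//.
  by rewrite lef_pV2 ?posrE// ler_nat.
have Fw n x : F n x -> (0 <= w x)%E.
  rewrite /F/= in_itv/= => /andP[h _].
  have x0 : 0 < x by apply: lt_trans h; rewrite invr_gt0.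
  by have /andP[] := wP x x0.
have cv : (\int[mu]_(x in F i) w x)%E @[i --> \oo] -->
    (\int[mu]_(x in \bigcup_i F i) w x)%E.
  apply: ge0_nondecreasing_set_cvg_integral => // n; first exact: measurable_itv.
  exact: measurable_funTS.
rewrite -(cvg_lim _ cv)//; apply: lime_le.
  by apply/cvg_ex; eexists; exact: cv.
by apply: nearW => n; apply: key; rewrite invr_gt0.
Qed.

End WeightTheory.

(** * Restrictions of functions and L^1 seminorms on sets *)

Section L1.
Context {d : measure_display} {T : measurableType d} {R : realType}.
Variable mu : {measure set T -> \bar R}.
Implicit Types (A B : set T) (f g : T -> R).

(** Written as a product so that it is literally the truncation occurring in [inM0]. *)
Definition cut B f : T -> R := fun x => f x * \1_B x.

(** A real-valued integral, in which an infinite value would read as 0; hence the integrability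
    premises in the comparison lemmas. *)
Definition L1 A f : R := \int[mu]_(x in A) `|f x|.

Lemma cut_in B f x : B x -> cut B f x = f x.
Proof. by move=> Bx; rewrite /cut indicE mem_set// mulr1. Qed.

Lemma cut_out B f x : ~ B x -> cut B f x = 0.
Proof. by move=> Bx; rewrite /cut indicE memNset// mulr0. Qed.

Lemma norm_cut_le B f x : `|cut B f x| <= `|f x|.
Proof.
have [Bx|Bx] := pselect (B x); first by rewrite cut_in.
by rewrite cut_out// normr0.
Qed.

Lemma cutI A B f : cut A (cut B f) = cut (A `&` B) f.
Proof. by apply/funext => x; rewrite /cut indicI/= mulrAC -mulrA. Qed.

Lemma cut_setU A B f : [disjoint A & B] ->
  cut (A `|` B) f = (fun x => cut A f x + cut B f x).
Proof.
move=> /disj_setPS AB; apply/funext => x.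
have [Ax|Ax] := pselect (A x).
  rewrite !(cut_in _ Ax) cut_in; last by left.
  by rewrite cut_out ?addr0// => Bx; apply: (AB x).
have [Bx|Bx] := pselect (B x).
  by rewrite (cut_in _ Bx) cut_in ?cut_out ?add0r//; right.
by rewrite !cut_out ?addr0// => -[].
Qed.

Lemma measurable_cut A B f : measurable A -> measurable B ->
  measurable_fun A f -> measurable_fun A (cut B f).
Proof.
by move=> mA mB mf; apply: measurable_funM.
Qed.

Lemma L1_ge0 A f : 0 <= L1 A f.
Proof. exact: Rintegral_ge0. Qed.

Lemma integrable_dominated A f g : measurable A -> measurable_fun A g ->
  (forall x, A x -> `|g x| <= `|f x|) ->
  mu.-integrable A (EFin \o f) -> mu.-integrable A (EFin \o g).
Proof.
by move=> mA mg gf; apply: le_integrable => //; exact/measurable_EFinP.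
Qed.

Lemma integrable_linear A f g (c : R) : measurable A ->
  mu.-integrable A (EFin \o f) -> mu.-integrable A (EFin \o g) ->
  mu.-integrable A (EFin \o (fun x => c * f x + g x)).
Proof.
move=> mA fA gA.
rewrite (_ : _ \o _ = (fun x => c%:E * (EFin \o f) x)%E \+ (EFin \o g))%E.
  by apply: integrableD => //; exact: integrableZl.
by apply/funext => x.
Qed.

Lemma L1_mono A f g : measurable A -> measurable_fun A g ->
  (forall x, A x -> `|g x| <= `|f x|) ->
  mu.-integrable A (EFin \o f) -> L1 A g <= L1 A f.
Proof.
move=> mA mg gf fA; apply: le_Rintegral => //; apply: integrable_norm => //.
exact: integrable_dominated gf fA.
Qed.

Lemma L1_linear_le A f g (c : R) : measurable A ->
  mu.-integrable A (EFin \o f) -> mu.-integrable A (EFin \o g) ->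
  L1 A (fun x => c * f x + g x) <= `|c| * L1 A f + L1 A g.
Proof.
move=> mA fA gA; have nf := integrable_norm fA; have ng := integrable_norm gA.
rewrite /L1 -RintegralZl// -RintegralD//; last first.
  rewrite (_ : _ \o _ = (fun x => `|c|%:E * (EFin \o (Num.norm \o f)) x)%E)//.
  exact: integrableZl.
apply: le_Rintegral => //.
- by apply: (@integrable_norm _ _ _ _ _ (fun x => c * f x + g x)); exact: integrable_linear.
- exact: (@integrable_linear A (Num.norm \o f) (Num.norm \o g)).
- by move=> x _; apply: le_trans (ler_normD _ _) _; rewrite normrM.
Qed.

Lemma L1_cut A B f : L1 A (cut B f) = L1 (A `&` B) f.
Proof.
rewrite /L1 Rintegral_mkcondr; apply: eq_Rintegral => x _; rewrite patchE.
case: ifPn => [/set_mem/cut_in ->//|xB].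
by rewrite cut_out ?normr0//; move/negP : xB; apply: contra_not => /mem_set.
Qed.

Lemma L1_sub A B f : measurable A -> measurable B -> A `<=` B ->
  mu.-integrable B (EFin \o f) -> L1 A f <= L1 B f.
Proof.
move=> mA mB AB fB; rewrite -(setIidr AB) -L1_cut; apply: L1_mono => //.
  apply: measurable_cut => //; apply/measurable_EFinP.
  exact: measurable_int fB.
by move=> x _; exact: norm_cut_le.
Qed.

Lemma L1_setU A B f : measurable A -> measurable B -> [disjoint A & B] ->
  mu.-integrable (A `|` B) (EFin \o f) ->
  L1 (A `|` B) f = L1 A f + L1 B f.
Proof. by move=> mA mB AB fAB; apply: Rintegral_setU => //; exact: integrable_norm. Qed.

Lemma L1_abs_continuous D f : measurable D -> mu.-integrable D (EFin \o f) ->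
  forall e, 0 < e -> exists2 del : R, 0 < del &
    forall A, measurable A -> A `<=` D -> (mu A < del%:E)%E -> L1 A f < e.
Proof.
move=> mD fD e e0.
have fT : mu.-integrable setT (EFin \o (f \_ D)).
  rewrite (_ : EFin \o _ = (EFin \o f) \_ D); last first.
    by apply/funext => x; rewrite /= !patchE; case: ifPn.
  exact/(integrable_mkcond _ mD).
have [del [del0 H]] := integral_normr_continuous fT e0.
exists del => // A mA AD Ad; have := H A mA Ad; apply: le_lt_trans.
rewrite /L1 le_eqVlt; apply/orP; left; apply/eqP; apply: eq_Rintegral => x.
by rewrite inE => Ax; rewrite patchE mem_set//; exact: AD.
Qed.

Lemma measure_decreasing_small (A : nat -> set T) :
  (mu (A 0%N) < +oo)%E -> (forall n, measurable (A n)) ->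
  (forall n, A n.+1 `<=` A n) -> mu (\bigcap_n A n) = 0%E ->
  forall e : R, 0 < e -> exists N, forall n, (N <= n)%N -> (mu (A n) < e%:E)%E.
Proof.
move=> A0 mA Ad muA e e0.
have : mu \o A @ \oo --> mu (\bigcap_n A n).
  apply: nonincreasing_cvg_mu => //; first exact: bigcap_measurable.
  by apply/nonincreasing_seqP => n; apply/subsetPset.
rewrite muA => h.
have [|N _ HN] := h [set u | (u < e%:E)%E]; first exact: open_ereal_lt'.
by exists N => n Nn; exact: HN.
Qed.

(** One of the sets {f >= 0} and {f < 0} carries at least half of the integral of |f|. This turns a
    large L^1 norm into a large value of the linear functional given by integration over B. *)
Lemma L1_half A f : measurable A -> mu.-integrable A (EFin \o f) ->
  exists B, [/\ measurable B, B `<=` A & L1 A f <= 2 * `|\int[mu]_(x in B) f x|].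
Proof.
move=> mA fA.
have mf : measurable_fun A f by apply/measurable_EFinP; exact: measurable_int fA.
pose P := A `&` [set x | 0 <= f x]; pose N := A `\` P.
have mP : measurable P.
  rewrite /P (_ : [set x | 0 <= f x] = f @^-1` `[0, +oo[%classic); last first.
    by apply/seteqP; split => x /=; rewrite in_itv/= andbT.
  exact: mf.
have mN : measurable N by exact: measurableD.
have PA : P `<=` A by exact: subIsetl.
have NA : N `<=` A by move=> x [].
have PN : A = P `|` N by rewrite setDUK.
have iP := integrableS mA mP PA fA; have iN := integrableS mA mN NA fA.
have EP : L1 P f = \int[mu]_(x in P) f x.
  by apply: eq_Rintegral => x; rewrite inE => -[_ /= ?]; rewrite ger0_norm.
have EN : L1 N f = - \int[mu]_(x in N) f x.
  rewrite -mulN1r -RintegralZl//; apply: eq_Rintegral => x; rewrite inE => -[Ax nP].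
  rewrite mulN1r ltr0_norm// ltNge; apply/negP => f0; exact: nP.
have EA : L1 A f = L1 P f + L1 N f.
  rewrite {1}PN L1_setU//; last by rewrite -PN.
  by apply/disj_setPS => x [Px [_]]; exact.
have [h|h] := leP (L1 N f) (L1 P f).
  by exists P; split => //; rewrite -EP ger0_norm ?L1_ge0//; lra.
exists N; split => //; rewrite -[X in `|X|]opprK -EN normrN ger0_norm ?L1_ge0//; lra.
Qed.

End L1.

(** * Decreasing rearrangement and the Marcinkiewicz norm *)

Section Rearrangement.
Variable R : realType.
Local Notation mu := (@lebesgue_measure R).
Implicit Types (f h : R -> R).

Lemma measurable_Dom : measurable (@Dom R).
Proof.
rewrite (_ : @Dom R = `[0, +oo[%classic); first exact: measurable_itv.
by apply/seteqP; split => x; rewrite /Dom /= in_itv/= andbT.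
Qed.

Lemma measurable_I0 (t : R) : measurable (I0 t).
Proof. exact: measurable_itv. Qed.

Lemma I0P (t x : R) : I0 t x <-> 0 <= x <= t.
Proof. by rewrite /I0 /= in_itv/=. Qed.

Lemma I0_Dom (t : R) : I0 t `<=` @Dom R.
Proof. by move=> x /I0P/andP[]. Qed.

Lemma measurable_superlevel h (l : R) : measurable_fun (@Dom R) h ->
  measurable (@Dom R `&` [set x | l < `|h x|]).
Proof.
move=> mh; rewrite (_ : [set x | l < `|h x|] = (Num.norm \o h) @^-1` `]l, +oo[%classic).
  by apply: measurableT_comp mh _ _ _ => //; exact: measurable_Dom.
by apply/seteqP; split => x /=; rewrite in_itv/= andbT.
Qed.

Lemma rearr_ge0 h (s : R) : (0 <= rearr h s)%E.
Proof. by apply: le_ereal_inf_tmp => _ [l [l0 _] <-]; rewrite lee_fin. Qed.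

Lemma rearr_le h (s l : R) : 0 <= l -> (distrib h l <= s%:E)%E ->
  (rearr h s <= l%:E)%E.
Proof. by move=> l0 hl; apply: ereal_inf_lbound; exists l. Qed.

Lemma rearr_ge h (s b : R) :
  (forall l, 0 <= l -> l < b -> (s%:E < distrib h l)%E) -> (b%:E <= rearr h s)%E.
Proof.
move=> H; apply: le_ereal_inf_tmp => _ [l [l0 hl] <-].
by rewrite lee_fin leNgt; apply/negP => lb; have := H l l0 lb; rewrite ltNge hl.
Qed.

Lemma rearr_nonincreasing h : {homo rearr h : s t / s <= t >-> (t <= s)%E}.
Proof.
move=> s t st; apply: le_ereal_inf_tmp => _ [l [l0 hl] <-].
by apply: rearr_le => //; apply: le_trans hl _; rewrite lee_fin.
Qed.

Lemma lebesgue_measure_cc (x y : R) : x <= y -> mu `[x, y]%classic = (y - x)%:E.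
Proof.
move=> xy; rewrite lebesgue_measure_itv/= lte_fin lt_neqAle xy andbT.
by case: eqVneq => [->|_]; rewrite /= ?subrr.
Qed.

Lemma le_lebesgue_measure (A B : set R) : measurable A -> measurable B ->
  A `<=` B -> (mu A <= mu B)%E.
Proof. by move=> mA mB AB; apply: le_measure; rewrite ?inE. Qed.

(** The interval [t, 3t] has measure 2t, strictly more than any s <= t, so the rearrangement is at
    least b on [0, t]. *)
Lemma Mnorm_ge phi h (t b : R) : measurable_fun (@Dom R) h ->
  0 < t -> 0 <= phi t -> (forall x, t <= x <= 3 * t -> b <= `|h x|) ->
  ((phi t * b)%:E <= Mnorm phi h)%E.
Proof.
move=> mh t0 phit hb.
have H s : s <= t -> (b%:E <= rearr h s)%E.
  move=> st; apply: rearr_ge => l l0 lb.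
  apply: (@lt_le_trans _ _ (mu `[t, 3 * t]%classic)).
    by rewrite lebesgue_measure_cc ?lte_fin; lra.
  apply: le_lebesgue_measure; [exact: measurable_itv|exact: measurable_superlevel|].
  move=> x /=; rewrite in_itv/= => /[dup] xt /andP[tx _]; split; rewrite /Dom /=; first lra.
  by apply: lt_le_trans lb _; exact: hb.
have [b0|b0] := leP 0 b; last first.
  apply: (@le_trans _ _ 0%E); first by rewrite lee_fin mulr_ge0_le0// ltW.
  apply: (@le_trans _ _ ((phi t / t)%:E * \int[mu]_(s in I0 t) rearr h s)%E).
    apply: mule_ge0; first by rewrite lee_fin divr_ge0// ltW.
    by apply: integral_ge0 => s _; exact: rearr_ge0.
  by apply: ereal_sup_ubound; exists t.
apply: (@le_trans _ _ ((phi t / t)%:E * \int[mu]_(s in I0 t) rearr h s)%E); last first.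
  by apply: ereal_sup_ubound; exists t.
apply: (@le_trans _ _ ((phi t / t)%:E * (b * t)%:E)%E).
  rewrite -EFinM lee_fin; have -> // : phi t / t * (b * t) = phi t * b.
  by field; rewrite gt_eqF.
apply: lee_wpmul2l; first by rewrite lee_fin divr_ge0// ltW.
apply: (@le_trans _ _ (\int[mu]_(s in I0 t) cst b%:E s)%E).
  rewrite integral_cst; last exact: measurable_I0.
  rewrite EFinM; apply: lee_wpmul2l; first by rewrite lee_fin.
  by rewrite -[t in t%:E]subr0 -(lebesgue_measure_cc (ltW t0)).
apply: ge0_le_integral; first exact: measurable_I0.
- by move=> x _; rewrite lee_fin.
- by [].
- by apply: measurable_funTS; apply: nonincreasing_emeasurable; exact: rearr_nonincreasing.
- by move=> x /I0P/andP[_ xt]; exact: H.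
Qed.

(** A weak-type bound on the rearrangement controls the full norm, because the average of 1 / phi
    over [0, t] is of the order of 1 / phi t. *)
Lemma Mnorm_le phi a r h (P : R) : weight phi a r -> 0 <= P ->
  (forall s, 0 < s -> (rearr h s <= (P / phi s)%:E)%E) ->
  (Mnorm phi h <= (r * a / (1 - r) * P)%:E)%E.
Proof.
move=> W P0 hP; apply: ge_ereal_sup => _ [t /= t0 <-].
have pt := weight_gt0 W t0.
apply: (@le_trans _ _ ((phi t / t)%:E * (P * (r * a) / (1 - r) * (t / phi t))%:E)%E).
  apply: lee_wpmul2l; first by rewrite lee_fin divr_ge0// ltW.
  apply: (integral_le_weight W P0 _ _ t0).
    by apply: nonincreasing_emeasurable; exact: rearr_nonincreasing.
  by move=> s s0; rewrite rearr_ge0 hP.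
rewrite -EFinM lee_fin le_eqVlt; apply/orP; left; apply/eqP.
by field; rewrite !gt_eqF// subr_gt0; exact: weight_r1 W.
Qed.

End Rearrangement.

(** * An equivalent norm and a description of the elements of the space *)

Section CesaroMarcinkiewicz.
Variables (R : realType) (phi : R -> R) (a r : R).
Hypothesis W : weight phi a r.
Local Notation mu := (@lebesgue_measure R).
Implicit Types (f g h : R -> R) (A : set R) (s t x e P : R).

Let phi_gt0 := weight_gt0 W.

Definition locint f := forall x : R, 0 < x -> mu.-integrable (I0 x) (EFin \o f).

Definition prim f (t : R) : R := L1 mu (I0 t) f.

(** The inequality [CesAbs f t <= P / phi t] with denominators cleared. The least such P is the
    working norm of f; it is compared with [CMnorm] through the constants 3 and r a / (1 - r). *)
Definition prim_bound f (P : R) := forall t : R, 0 < t -> phi t * prim f t <= P * t.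

Definition vanishing f := forall e : R, 0 < e -> exists2 tau : R, 0 < tau &
  exists2 T : R, tau <= T &
    forall t, 0 < t -> t <= tau \/ T <= t -> phi t * prim f t <= e * t.

Lemma CesAbsE f x : CesAbs f x = prim f x / x.
Proof. by []. Qed.

Lemma prim_ge0 f t : 0 <= prim f t.
Proof. exact: L1_ge0. Qed.

Lemma prim_le f s t : locint f -> s <= t -> prim f s <= prim f t.
Proof.
move=> fl st; have [t0|t0] := ltP 0 t.
  apply: L1_sub; [exact: measurable_I0|exact: measurable_I0| |exact: fl].
  by move=> x /I0P/andP[x0 xs]; apply/I0P; rewrite x0 (le_trans xs).
have [->//|nst] := eqVneq s t.
have s0 : s < 0 by apply: lt_le_trans t0; rewrite lt_neqAle nst.
rewrite /prim (_ : I0 s = set0) ?L1_ge0 //; last first.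
  apply/seteqP; split => x // /I0P/andP[x0 xs].
  by have := le_lt_trans (le_trans x0 xs) s0; rewrite ltxx.
by rewrite /L1 Rintegral_set0 L1_ge0.
Qed.

Lemma measurable_CesAbs f : locint f -> measurable_fun (@Dom R) (CesAbs f).
Proof.
move=> fl; rewrite (_ : CesAbs f = (fun x => prim f x * x^-1)); last by apply/funext.
have E : @Dom R = `[0, +oo[%classic.
  by apply/seteqP; split => x; rewrite /Dom /= in_itv/= andbT.
rewrite E; apply: measurable_funM.
  apply: nondecreasing_measurable => // s t; exact: prim_le.
apply/measurable_fun_itv_obnd_cbndP.
apply: open_continuous_measurable_fun; first exact: interval_open.
move=> x; rewrite inE/= in_itv/= andbT => x0; apply: inv_continuous.
by rewrite gt_eqF.
Qed.

Lemma measurable_cut_CesAbs f A : locint f -> measurable A ->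
  measurable_fun (@Dom R) (cut A (CesAbs f)).
Proof.
by move=> fl mA; apply: measurable_cut => //;
  [exact: measurable_Dom|exact: measurable_CesAbs].
Qed.

Lemma CesAbs_ge0 f x : 0 <= x -> 0 <= CesAbs f x.
Proof. by move=> x0; rewrite CesAbsE divr_ge0// prim_ge0. Qed.

(** On [t, 3t] the numerator of [CesAbs f] is at least [prim f t] and the denominator at most 3t,
    although [CesAbs f] itself need not be monotone. *)
Lemma Mnorm_cut_ge f A t : locint f -> measurable A -> 0 < t ->
  (forall x, t <= x <= 3 * t -> A x) ->
  ((phi t * (prim f t / (3 * t)))%:E <= Mnorm phi (cut A (CesAbs f)))%E.
Proof.
move=> fl mA t0 tA; apply: Mnorm_ge => //.
- exact: measurable_cut_CesAbs.
- exact/ltW/phi_gt0.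
- move=> x /[dup] /tA Ax /andP[tx xt]; have x0 := lt_le_trans t0 tx.
  rewrite cut_in// ger0_norm ?CesAbs_ge0 ?(ltW x0)// CesAbsE.
  apply: ler_pM; rewrite ?prim_ge0 ?invr_ge0 ?mulr_ge0 ?(ltW t0)//.
    exact: (prim_le fl tx).
  by rewrite lef_pV2 ?posrE ?mulr_gt0.
Qed.

Lemma cut_setT f : cut setT f = f.
Proof. by apply/funext => x; rewrite cut_in. Qed.

Lemma prim_bound_ge0 f P : prim_bound f P -> 0 <= P.
Proof.
move=> /(_ 1 ltr01); rewrite mulr1; apply: le_trans.
by rewrite mulr_ge0 ?prim_ge0// ltW// phi_gt0.
Qed.

Lemma prim_bound_CesAbs f (P t : R) : 0 < t ->
  phi t * prim f t <= P * t -> CesAbs f t <= P / phi t.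
Proof.
move=> t0 h; rewrite CesAbsE ler_pdivlMr ?phi_gt0// mulrAC ler_pdivrMr//.
by rewrite mulrC.
Qed.

Lemma ltr_weight s x : 0 < s -> 0 < x -> phi x < phi s -> x < s.
Proof.
move=> s0 x0 h; rewrite ltNge; apply/negP => /(weight_le W s0).
by rewrite leNgt h.
Qed.

Lemma weight_half s : 0 < s -> phi s <= 2 * phi (s / 2).
Proof.
move=> s0; have s20 : 0 < s / 2 by rewrite divr_gt0.
have s2s : s / 2 <= s by lra.
have := weight_ratio W s20 s2s; rewrite ler_pdivrMr// => /le_trans; apply.
by rewrite le_eqVlt; apply/orP; left; apply/eqP; field; rewrite gt_eqF.
Qed.

(** [CesAbs f] lies below the nonincreasing function P / phi, so it exceeds the level P / phi s only
    inside [0, s]. *)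
Lemma Mnorm_CesAbs_le f P : locint f -> prim_bound f P ->
  (Mnorm phi (CesAbs f) <= (r * a / (1 - r) * P)%:E)%E.
Proof.
move=> fl fP; have P0 := prim_bound_ge0 fP; apply: Mnorm_le => // s s0.
have ps := phi_gt0 s0.
apply: rearr_le; first by rewrite divr_ge0// ltW.
rewrite -[s in s%:E]subr0 -(lebesgue_measure_cc (ltW s0)).
apply: le_lebesgue_measure;
  [by apply: measurable_superlevel; exact: measurable_CesAbs|exact: measurable_itv|].
move=> x [x0 /=]; rewrite ger0_norm ?CesAbs_ge0// in_itv/= => h.
have {}x0 : 0 <= x by []; rewrite x0/=.
have /predU1P[<-|{}x0] : (0 == x) || (0 < x) by rewrite -le_eqVlt.
  exact: ltW.
have := lt_le_trans h (prim_bound_CesAbs x0 (fP x x0)).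
have px := phi_gt0 x0; rewrite ltr_pdivrMr// mulrAC ltr_pdivlMr// => hh.
apply/ltW/ltr_weight => //.
have [P00|P00] := eqVneq P 0; first by move: hh; rewrite P00 !mul0r ltxx.
by move: hh; rewrite ltr_pM2l// lt_neqAle eq_sym P00.
Qed.

(** Only t between tau and T needs an argument; there both factors are at most their values at T,
    and t is at least tau. *)
Lemma vanishing_prim_bound f : locint f -> vanishing f ->
  exists P, prim_bound f P.
Proof.
move=> fl /(_ 1 ltr01)[tau tau0 [T tauT fT]].
have T0 := lt_le_trans tau0 tauT.
exists (1 + phi T * prim f T / tau) => t t0.
have p0 : 0 <= phi T * prim f T / tau.
  by rewrite divr_ge0 ?(ltW tau0)// mulr_ge0 ?prim_ge0// ltW// phi_gt0.
rewrite mulrDl; have [tt|tt] := leP t tau.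
  apply: le_trans (fT t t0 (or_introl tt)) _.
  by rewrite lerDl mulr_ge0// ltW.
have [Tt|Tt] := leP T t.
  apply: le_trans (fT t t0 (or_intror Tt)) _.
  by rewrite lerDl mulr_ge0// ltW.
apply: (@le_trans _ _ (phi T * prim f T / tau * t)); last by rewrite lerDr mul1r ltW.
apply: (@le_trans _ _ (phi T * prim f T)).
  apply: ler_pM; rewrite ?prim_ge0//; first by rewrite ltW// phi_gt0.
    exact: (weight_le W t0 (ltW Tt)).
  exact: (prim_le fl (ltW Tt)).
rewrite -mulrA ler_peMr// ?mulr_ge0 ?prim_ge0//; first by rewrite ltW// phi_gt0.
by rewrite mulrC ler_pdivlMr// mul1r ltW.
Qed.

Lemma ecvg0 (u : nat -> \bar R) : (forall n, 0 <= u n)%E ->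
  (forall e : R, 0 < e -> exists N, forall n, (N <= n)%N -> (u n <= e%:E)%E) ->
  u @ \oo --> 0%E.
Proof.
move=> u0 H; apply/fine_cvgP; split.
  have [N HN] := H 1 ltr01; exists N => // n /= Nn.
  by rewrite ge0_fin_numE//; apply: le_lt_trans (HN n Nn) _; rewrite ltry.
apply: eventually_cvg0 => e e0; have [N HN] := H e e0.
exists N => n Nn; rewrite /= ger0_norm ?fine_ge0//.
by have := HN n Nn; have := u0 n; case: (u n).
Qed.

Lemma ecvg0_eventually (u : nat -> \bar R) : u @ \oo --> 0%E ->
  forall e : R, 0 < e -> exists N, forall n, (N <= n)%N -> (u n < e%:E)%E.
Proof.
move=> h e e0; have [|N _ HN] := h [set u | (u < e%:E)%E].
  exact: open_ereal_lt'.
by exists N => n Nn; exact: HN.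
Qed.

Lemma Mnorm_ge0 h : (0 <= Mnorm phi h)%E.
Proof.
apply: (@le_trans _ _ ((phi 1 / 1)%:E * \int[mu]_(s in I0 1) rearr h s)%E).
  apply: mule_ge0; first by rewrite lee_fin divr_ge0// ltW// phi_gt0.
  by apply: integral_ge0 => s _; exact: rearr_ge0.
by apply: ereal_sup_ubound; exists 1 => //=.
Qed.

(** Outside J = [tau, T] one has [CesAbs f <= e / phi]; on J it is below K and [A n] has small
    measure. If s is small, e / phi s is at least K and J does not contribute. If s >= del, the part
    in J takes measure at most s / 2 and the rest lies in [0, s/2], since phi s <= 2 phi(s/2); this
    is the factor 2 in the bound. *)
Lemma vanishing_rearr f (A : nat -> set R) : locint f -> vanishing f ->
  (forall n, measurable (A n)) -> (forall n, A n.+1 `<=` A n) ->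
  mu (\bigcap_n A n) = 0%E -> forall e : R, 0 < e ->
  exists N, forall n, (N <= n)%N -> forall s, 0 < s ->
    (rearr (cut (A n) (CesAbs f)) s <= (2 * e / phi s)%:E)%E.
Proof.
move=> fl fv mA Ad muA e e0; have [tau tau0 [T tauT fT]] := fv e e0.
have T0 := lt_le_trans tau0 tauT.
pose J : set R := `[tau, T]%classic.
pose K := prim f T / tau + 1.
have K0 : 0 < K by rewrite ltr_wpDl// divr_ge0 ?prim_ge0// ltW.
have [del del0 Hdel] := weight_at0 W (divr_gt0 e0 K0).
have mJ : measurable J by exact: measurable_itv.
have [N HN] : exists N, forall n, (N <= n)%N -> (mu (A n `&` J) < (del / 2)%:E)%E.
  apply: (@measure_decreasing_small _ _ R mu (fun n => A n `&` J)).
  - apply: (@le_lt_trans _ _ (mu J)); last by rewrite /J lebesgue_measure_cc// ltry.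
    by apply: le_lebesgue_measure => //; exact: measurableI.
  - by move=> n; exact: (measurableI _ _ (mA n) mJ).
  - by move=> n x [Ax Jx]; split => //; exact: Ad.
  - apply/eqP; rewrite eq_le measure_ge0 andbT -muA.
    apply: le_lebesgue_measure.
    + by apply: bigcap_measurable => // n _; exact: measurableI.
    + exact: bigcap_measurable.
    + by move=> x Hx n _; have [] := Hx n I.
  - by rewrite divr_gt0.
exists N => n Nn s s0; have ps := phi_gt0 s0.
set h := cut _ _.
have mh : measurable_fun (@Dom R) h by exact: measurable_cut_CesAbs.
have hle l x : 0 <= l -> Dom x -> l < `|h x| -> [/\ 0 < x, A n x & l < CesAbs f x].
  rewrite /Dom/= => l0 x0 lh.
  have [Ax|Ax] := pselect (A n x); last first.
    by move: lh; rewrite /h cut_out// normr0 ltNge l0.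
  move: lh; rewrite /h cut_in// ger0_norm ?CesAbs_ge0// => lh.
  split => //; move: x0; rewrite le_eqVlt => /predU1P[x0|//].
  by move: lh; rewrite -x0 CesAbsE invr0 mulr0 ltNge l0.
have out x : 0 < x -> ~ J x -> CesAbs f x <= e / phi x.
  move=> x0 nJ; apply: prim_bound_CesAbs => //; apply: fT => //.
  have [|h1] := leP x tau; first by left.
  right; rewrite leNgt; apply/negP => xT; apply: nJ.
  by rewrite /J/= in_itv/= !ltW.
have [sd|ds] := ltP s del.
  apply: (@le_trans _ _ (e / phi s)%:E); last first.
    by rewrite lee_fin ler_wpM2r ?invr_ge0 ?(ltW ps)//; lra.
  apply: rearr_le; first by rewrite divr_ge0// ltW.
  rewrite -[s in s%:E]subr0 -(lebesgue_measure_cc (ltW s0)).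
  apply: le_lebesgue_measure; [exact: measurable_superlevel|exact: measurable_itv|].
  move=> x [Dx /= /hle]; rewrite divr_ge0 ?(ltW e0) ?(ltW ps)// => /(_ isT Dx)[x0 Ax lx].
  rewrite in_itv/= (ltW x0)/=; have px := phi_gt0 x0.
  have [Jx|nJ] := pselect (J x).
    exfalso; have := Hdel s s0 sd; rewrite ler_pdivlMr// mulrC -ler_pdivlMr// leNgt.
    move=> /negP; apply; apply: lt_trans lx _.
    rewrite /K ltr_pwDr// CesAbsE; move: Jx; rewrite /J/= in_itv/= => /andP[h1 h2].
    apply: ler_pM; rewrite ?prim_ge0 ?invr_ge0 ?(ltW x0)//; first exact: prim_le.
    by rewrite lef_pV2 ?posrE.
  apply/ltW/ltr_weight => //.
  have := lt_le_trans lx (out x x0 nJ).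
  by rewrite ltr_pdivrMr// mulrAC ltr_pdivlMr// ltr_pM2l.
apply: rearr_le; first by rewrite divr_ge0 ?mulr_ge0// ltW.
apply: (@le_trans _ _ (mu (`[0, s / 2]%classic `|` (A n `&` J)))).
  apply: le_lebesgue_measure; first exact: measurable_superlevel.
    by apply: measurableU; [exact: measurable_itv|exact: measurableI].
  move=> x [Dx /= /hle]; rewrite divr_ge0 ?mulr_ge0 ?(ltW e0) ?(ltW ps)// => /(_ isT Dx)[x0 Ax lx].
  have [Jx|nJ] := pselect (J x); first by right.
  left; rewrite /= in_itv/= (ltW x0)/= leNgt; apply/negP => sx.
  have px := phi_gt0 x0; have s20 : 0 < s / 2 by rewrite divr_gt0.
  have := lt_le_trans lx (out x x0 nJ).
  rewrite ltr_pdivrMr// mulrAC ltr_pdivlMr// mulrAC mulrC ltr_pM2l//.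
  rewrite ltNge => /negP; apply.
  apply: le_trans (weight_half s0) _; rewrite ler_pM2l//.
  exact: (weight_le W s20 (ltW sx)).
apply: (@le_trans _ _ ((s / 2)%:E + (del / 2)%:E)%E).
  apply: le_trans (measureU2 _ _ _) _; [exact: measurable_itv|exact: (measurableI _ _ (mA n) mJ)|].
  apply: leeD; last by rewrite ltW// HN.
  have s20 : 0 <= s / 2 by rewrite divr_ge0// ltW.
  by rewrite -[s / 2]subr0 -(lebesgue_measure_cc s20) subr0.
by rewrite -EFinD lee_fin -mulrDl ler_pdivrMr// mulr_natr mulr2n lerD2l.
Qed.

(** Order continuity is tested on [0, 1/(n+1)] and on [n, oo), which decrease to null sets; the
    lower bound on [t, 3t] then controls the quotient at both ends. Conversely the weak-type bounds
    of [vanishing_rearr] pass to the norm. *)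
Lemma inCM0P f : inCM0 phi f <->
  [/\ measurable_fun (@Dom R) f, locint f & vanishing f].
Proof.
have r1 := weight_r1 W; have a0 := lt_trans ltr01 (weight_a1 W); have r0 := weight_r0 W.
have C0 : 0 < r * a / (1 - r) by rewrite divr_gt0 ?mulr_gt0 ?subr_gt0.
split=> [[mf [fl [_ oc]]]|[mf fl fv]].
  split=> // e e0; have e3 : 0 < e / 3 by rewrite divr_gt0.
  have fin t A : 0 < t -> measurable A -> (forall x, t <= x <= 3 * t -> A x) ->
      (Mnorm phi (cut A (CesAbs f)) < (e / 3)%:E)%E -> phi t * prim f t <= e * t.
    move=> t0 mA tA h; have := le_lt_trans (Mnorm_cut_ge fl mA t0 tA) h.
    rewrite lte_fin mulrA ltr_pdivrMr ?mulr_gt0// => /ltW/le_trans; apply.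
    by rewrite le_eqVlt; apply/orP; left; apply/eqP; field.
  pose A1 n : set R := `[0, n.+1%:R^-1]%classic.
  pose A2 n : set R := `[n%:R, +oo[%classic.
  have [n1 Hn1] : exists N, forall n, (N <= n)%N ->
      (Mnorm phi (cut (A1 n) (CesAbs f)) < (e / 3)%:E)%E.
    apply: ecvg0_eventually => //; apply: oc => [n|n x|].
    - exact: measurable_itv.
    - rewrite /A1/= !in_itv/= => /andP[-> /le_trans]; apply.
      by rewrite lef_pV2 ?posrE// ler_nat.
    - rewrite (_ : \bigcap_n A1 n = [set 0]) ?lebesgue_measure_set1//.
      apply/seteqP; split => [x Hx|x /= -> n _]; last by rewrite /A1/= in_itv/= lexx invr_ge0 ler0n.
      have := Hx 0%N I; rewrite /A1/= in_itv/= => /andP[x0 _].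
      apply/eqP; rewrite eq_le x0 andbT leNgt; apply/negP => {}x0.
      have [n Hn] := @ltr_add_invr R 0 x x0; have := Hx n I; rewrite /A1/= in_itv/= => /andP[_].
      by rewrite leNgt; move: Hn; rewrite add0r => ->.
  have [n2 Hn2] : exists N, forall n, (N <= n)%N ->
      (Mnorm phi (cut (A2 n) (CesAbs f)) < (e / 3)%:E)%E.
    apply: ecvg0_eventually => //; apply: oc => [n|n x|].
    - exact: measurable_itv.
    - rewrite /A2/= !in_itv/= !andbT; apply: le_trans.
      by rewrite ler_nat.
    - rewrite (_ : \bigcap_n A2 n = set0) ?measure0//.
      apply/seteqP; split => // x Hx.
      have := Hx (Num.bound `|x|) I; rewrite /A2/= in_itv/= andbT.
      by apply/negP; rewrite -ltNge (le_lt_trans (ler_norm x))// archi_boundP.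
  (* The factor 3 keeps [t, 3t] inside the set [A1 n1]; the 1 added to n2 below guarantees
     [tau <= T]. *)
  exists ((3 * n1.+1%:R)^-1); first by rewrite invr_gt0 mulr_gt0.
  exists (n2 + 1)%:R.
    by rewrite natrD (@le_trans _ _ 1)// ?lerDr// invf_le1 ?mulr_gt0// mulr_ege1// ?ler1n//; lra.
  move=> t t0 [tt|tt].
    apply: (fin t (A1 n1)) => //; [exact: measurable_itv| |exact: Hn1].
    move=> x /andP[tx xt]; rewrite /A1/= in_itv/= (le_trans (ltW t0) tx)/=.
    apply: le_trans xt _; move: tt; by rewrite invfM ler_pdivlMl.
  apply: (fin t (A2 n2)) => //; [exact: measurable_itv| |exact: Hn2].
  move=> x /andP[tx xt]; rewrite /A2/= in_itv/= andbT.
  by apply: le_trans tx; apply: le_trans tt; rewrite ler_nat leq_addr.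
split => //; split => //; split.
  split; first exact: measurable_CesAbs.
  have [P fP] := vanishing_prim_bound fl fv.
  by apply: le_lt_trans (Mnorm_CesAbs_le fl fP) _; rewrite ltry.
move=> A mA Ad muA; apply: ecvg0 => [n|e e0]; first exact: Mnorm_ge0.
(* The choice of the small constant makes [Mnorm_le] return exactly e. *)
have [|N HN] := vanishing_rearr fl fv mA Ad muA (e := e / (2 * (r * a / (1 - r)))).
  by rewrite divr_gt0// mulr_gt0.
exists N => n Nn; have H := HN n Nn.
have P0 : 0 <= 2 * (e / (2 * (r * a / (1 - r)))).
  by rewrite mulr_ge0// divr_ge0 ?(ltW e0)// (@mulr_ge0 _ 2)// ltW.
apply: le_trans (Mnorm_le W P0 H) _; rewrite lee_fin le_eqVlt; apply/orP; left.
by apply/eqP; field; rewrite !gt_eqF// subr_gt0.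
Qed.

End CesaroMarcinkiewicz.

(** * Linear structure of the space, its dual and its bidual *)

Section FunctionSpace.
Variables (R : realType) (phi : R -> R) (a r : R).
Hypothesis W : weight phi a r.
Local Notation mu := (@lebesgue_measure R).
Local Notation C := (r * a / (1 - r)).
Local Notation X := (inCM0 phi).
Implicit Types (f g h : R -> R) (A B : set R) (s t x e P c : R).

Let phi_gt0 := weight_gt0 W.

Lemma C_gt0 : 0 < C.
Proof.
rewrite divr_gt0 ?mulr_gt0 ?subr_gt0 ?(weight_r0 W) ?(weight_r1 W)//.
exact: lt_trans ltr01 (weight_a1 W).
Qed.

Lemma inCM0_measurable f : X f -> measurable_fun (@Dom R) f.
Proof. by move=> /(inCM0P W)[]. Qed.

Lemma inCM0_locint f : X f -> locint f.
Proof. by move=> /(inCM0P W)[]. Qed.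

Lemma measurable_fun_Dom A f : measurable A -> A `<=` @Dom R ->
  measurable_fun (@Dom R) f -> measurable_fun A f.
Proof.
move=> mA AD; apply: measurable_funS => //; exact: measurable_Dom.
Qed.

Lemma inCM0_integrable f A t : X f -> measurable A -> 0 < t -> A `<=` I0 t ->
  mu.-integrable A (EFin \o f).
Proof.
move=> Xf mA t0 At; apply: integrableS (inCM0_locint Xf t0) => //.
exact: measurable_I0.
Qed.

Lemma locint_dominated f g : locint f -> measurable_fun (@Dom R) g ->
  (forall x, 0 <= x -> `|g x| <= `|f x|) -> locint g.
Proof.
move=> fl mg gf x x0; apply: (integrable_dominated _ _ _ (fl x x0)).
- exact: measurable_I0.
- by apply: measurable_fun_Dom mg; [exact: measurable_I0|exact: I0_Dom].
- by move=> y /I0P/andP[/gf].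
Qed.

Lemma prim_mono f g t : locint f -> measurable_fun (@Dom R) g ->
  (forall x, 0 <= x -> `|g x| <= `|f x|) -> 0 < t -> prim g t <= prim f t.
Proof.
move=> fl mg gf t0; apply: L1_mono (fl t t0).
- exact: measurable_I0.
- by apply: measurable_fun_Dom mg; [exact: measurable_I0|exact: I0_Dom].
- by move=> y /I0P/andP[/gf].
Qed.

Lemma inCM0_dominated f g : X f -> measurable_fun (@Dom R) g ->
  (forall x, 0 <= x -> `|g x| <= `|f x|) -> X g.
Proof.
move=> /(inCM0P W)[mf fl fv] mg gf; apply/(inCM0P W); split => //.
  exact: locint_dominated gf.
move=> e e0; have [tau tau0 [T tT H]] := fv e e0.
exists tau => //; exists T => // t t0 ht; apply: le_trans (H t t0 ht).
by rewrite ler_pM2l ?phi_gt0//; exact: prim_mono.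
Qed.

Lemma measurable_cut_Dom f A : measurable A -> measurable_fun (@Dom R) f ->
  measurable_fun (@Dom R) (cut A f).
Proof. by move=> mA mf; apply: measurable_cut => //; exact: measurable_Dom. Qed.

Lemma inCM0_cut f A : X f -> measurable A -> X (cut A f).
Proof.
move=> Xf mA; apply: inCM0_dominated (Xf) _ _.
  by apply: measurable_cut_Dom => //; exact: inCM0_measurable.
by move=> x _; exact: norm_cut_le.
Qed.

Lemma prim_linear_le f g c t : locint f -> locint g -> 0 < t ->
  prim (fun x => c * f x + g x) t <= `|c| * prim f t + prim g t.
Proof.
move=> fl gl t0; apply: L1_linear_le; [exact: measurable_I0|exact: fl|exact: gl].
Qed.

Lemma prim_bound_linear f g c P P' : locint f -> locint g ->
  prim_bound phi f P -> prim_bound phi g P' ->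
  prim_bound phi (fun x => c * f x + g x) (`|c| * P + P').
Proof.
move=> fl gl fP gP t t0.
apply: (@le_trans _ _ (phi t * (`|c| * prim f t + prim g t))).
  by rewrite ler_pM2l ?phi_gt0//; exact: prim_linear_le.
rewrite mulrDr mulrDl; apply: lerD; last exact: gP.
by rewrite mulrCA -mulrA ler_wpM2l//; exact: fP.
Qed.

Lemma locint_linear f g c : locint f -> locint g ->
  locint (fun x => c * f x + g x).
Proof.
move=> fl gl t t0; apply: integrable_linear; [exact: measurable_I0|exact: fl|exact: gl].
Qed.

Lemma inCM0_linear f g c : X f -> X g -> X (fun x => c * f x + g x).
Proof.
move=> /(inCM0P W)[mf fl fv] /(inCM0P W)[mg gl gv]; apply/(inCM0P W); split.
- by apply: measurable_funD => //; exact: measurable_funM.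
- exact: locint_linear.
move=> e e0; have c0 : 0 < `|c| + 1 by rewrite ltr_wpDl.
pose d := e / (`|c| + 1); have d0 : 0 < d by rewrite divr_gt0.
have [tau tau0 [T tT H]] := fv d d0; have [tau' tau'0 [T' tT' H']] := gv d d0.
exists (Num.min tau tau'); first by rewrite lt_min tau0.
exists (Num.max T T'); first by rewrite ge_min !le_max tT.
move=> t t0 ht.
have h1 : phi t * prim f t <= d * t.
  by apply: H => //; move: ht; rewrite le_min ge_max => -[]/andP[]; [left|right].
have h2 : phi t * prim g t <= d * t.
  by apply: H' => //; move: ht; rewrite le_min ge_max => -[]/andP[]; [left|right].
apply: (@le_trans _ _ (phi t * (`|c| * prim f t + prim g t))).
  by rewrite ler_pM2l ?phi_gt0//; exact: prim_linear_le.
have -> : e * t = `|c| * (d * t) + d * t by rewrite /d; field; rewrite gt_eqF.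
by rewrite mulrDr; apply: lerD => //; rewrite mulrCA ler_wpM2l.
Qed.

Lemma inCM0_0 : X (fun=> 0).
Proof.
have p0 t : prim (fun=> 0 : R) t = 0.
  rewrite /prim /L1; under eq_Rintegral do rewrite normr0.
  by rewrite Rintegral_cst ?mul0r//; exact: measurable_I0.
apply/(inCM0P W); split => //.
  move=> x _; rewrite (_ : EFin \o _ = cst 0%E)//; exact: integrable0.
move=> e e0; exists 1 => //; exists 1 => // t t0 _.
by rewrite p0 mulr0 mulr_ge0// ltW.
Qed.

Definition band (M : R) : set R := `[M^-1, M]%classic.

Lemma measurable_band M : measurable (band M).
Proof. exact: measurable_itv. Qed.

Lemma bandP M x : band M x <-> M^-1 <= x <= M.
Proof. by rewrite /band /= in_itv/=. Qed.

Lemma band_I0 M : 0 < M -> band M `<=` I0 M.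
Proof.
move=> M0 x /bandP/andP[h1 h2]; apply/I0P; rewrite h2 andbT.
by apply: le_trans h1; rewrite invr_ge0 ltW.
Qed.

Lemma fine_mu_sub A B (b : R) : measurable A -> measurable B -> A `<=` B ->
  (mu B <= b%:E)%E -> fine (mu A) <= b.
Proof.
move=> mA mB AB Bb; have h := le_trans (le_lebesgue_measure mA mB AB) Bb.
rewrite -lee_fin fineK// ge0_fin_numE//.
by apply: le_lt_trans h _; rewrite ltry.
Qed.

Lemma mu_I0 t : 0 < t -> mu (I0 t) = t%:E.
Proof. by move=> t0; rewrite /I0 lebesgue_measure_cc ?subr0// ltW. Qed.

Lemma mu_band_fin M A : 0 < M -> measurable A -> A `<=` band M -> mu A \is a fin_num.
Proof.
move=> M0 mA AB; rewrite ge0_fin_numE//.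
apply: (@le_lt_trans _ _ (mu (I0 M))); last by rewrite mu_I0// ltry.
apply: le_lebesgue_measure => //; first exact: measurable_I0.
by apply: subset_trans AB _; exact: band_I0.
Qed.

Lemma L1_indic A B : measurable A -> L1 mu A (\1_B) = L1 mu (A `&` B) (cst 1).
Proof.
move=> mA; rewrite -L1_cut; apply: eq_Rintegral => x _; congr (`|_|).
by rewrite /cut mul1r.
Qed.

Lemma L1_one A : measurable A -> L1 mu A (cst 1) = fine (mu A).
Proof.
move=> mA; rewrite /L1 -[RHS]mul1r -Rintegral_cst//.
by apply: eq_Rintegral => x _; rewrite /= normr1.
Qed.

Lemma integrable_bounded A f (M b : R) : measurable A -> 0 < M -> A `<=` I0 M ->
  measurable_fun A f -> (forall x, A x -> `|f x| <= b) ->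
  mu.-integrable A (EFin \o f).
Proof.
move=> mA M0 AM mf fb; apply: measurable_bounded_integrable => //.
  apply: (@le_lt_trans _ _ (mu (I0 M))); last by rewrite mu_I0// ltry.
  by apply: le_lebesgue_measure => //; exact: measurable_I0.
exists b; split; first exact: num_real.
by move=> y yb x Ax; apply: le_trans (fb x Ax) _; exact: ltW.
Qed.

(** The primitive is 0 before 1/M and never exceeds M, while phi t / t tends to 0 at infinity. *)
Lemma inCM0_indic M A : 0 < M -> measurable A -> A `<=` band M -> X (\1_A).
Proof.
move=> M0 mA AM; have Mi0 : 0 < M^-1 by rewrite invr_gt0.
have fl : locint (\1_A : R -> R).
  move=> x x0; apply: (integrable_bounded (b := 1) (M := x)) => //.
  - exact: measurable_I0.
  - by move=> y _; rewrite indicE; case: (y \in A); rewrite ?normr1 ?normr0.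
apply/(inCM0P W); split => //.
have pM t : prim (\1_A : R -> R) t <= M.
  have mI : measurable (I0 t `&` A) by apply: measurableI => //; exact: measurable_I0.
  have IM : I0 t `&` A `<=` I0 M by move=> x [_ /AM/(band_I0 M0)].
  rewrite /prim L1_indic; last exact: measurable_I0.
  rewrite L1_one//; apply: (fine_mu_sub mI (@measurable_I0 R M) IM).
  by rewrite mu_I0.
move=> e e0; have [T T0 HT] := weight_at_infty W (divr_gt0 e0 M0).
exists (Num.min (M^-1 / 2) T); first by rewrite lt_min divr_gt0.
exists T; first by rewrite ge_min lexx orbT.
move=> t t0 []; first last.
  move=> /HT h; rewrite -ler_pdivrMr// mulrAC.
  apply: (@le_trans _ _ (e / M * M)); last by rewrite divfK// gt_eqF.
  by apply: ler_pM => //; rewrite ?divr_ge0 ?prim_ge0 ?(ltW t0) ?(ltW (phi_gt0 t0)).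
rewrite le_min => /andP[tM _].
suff -> : prim (\1_A : R -> R) t = 0 by rewrite mulr0 mulr_ge0// ltW.
rewrite /prim L1_indic; last exact: measurable_I0.
rewrite (_ : I0 t `&` A = set0); first by rewrite /L1 Rintegral_set0.
apply/seteqP; split => // x [/I0P/andP[_ xt] /AM/bandP/andP[Mx _]].
lra.
Qed.

Lemma CMnorm_ge0 f : 0 <= CMnorm phi f.
Proof. by rewrite /CMnorm fine_ge0// (Mnorm_ge0 W). Qed.

Lemma prim_le_CMnorm f t : X f -> 0 < t ->
  phi t * prim f t <= 3 * CMnorm phi f * t.
Proof.
move=> Xf t0; have [_ [_ [[_ fin] _]]] := Xf.
have := @Mnorm_cut_ge _ _ _ _ W f setT t (inCM0_locint Xf) measurableT t0 (fun _ _ => I).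
rewrite cut_setT -[Mnorm _ _]fineK; last by rewrite ge0_fin_numE// (Mnorm_ge0 W).
rewrite lee_fin mulrA ler_pdivrMr ?mulr_gt0// -/(CMnorm phi f) => /le_trans; apply.
by rewrite mulrA (mulrC 3).
Qed.

Lemma CMnorm_le f P : X f -> prim_bound phi f P -> CMnorm phi f <= C * P.
Proof.
move=> Xf fP; have [_ [_ [[_ fin] _]]] := Xf.
rewrite -lee_fin /CMnorm fineK; last by rewrite ge0_fin_numE// (Mnorm_ge0 W).
exact: (Mnorm_CesAbs_le W (inCM0_locint Xf) fP).
Qed.

Lemma prim_bound_scale f c P : X f -> prim_bound phi f P ->
  prim_bound phi (fun x => c * f x) (`|c| * P).
Proof.
move=> Xf fP.
have p0 : prim_bound phi (fun=> 0) 0.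
  move=> t t0; rewrite mul0r /prim /L1; under eq_Rintegral do rewrite normr0.
  by rewrite Rintegral_cst ?mul0r ?mulr0//; exact: measurable_I0.
have := prim_bound_linear c (inCM0_locint Xf) (inCM0_locint inCM0_0) fP p0.
rewrite addr0 (_ : (fun x => _) = (fun x => c * f x))//.
by apply/funext => x; rewrite addr0.
Qed.

Section Dual.
Implicit Types v : (R -> R) -> R.

Lemma dual_linear v f g c : dualX phi v -> X f -> X g ->
  v (fun x => c * f x + g x) = c * v f + v g.
Proof. by move=> [+ _]; exact. Qed.

Lemma dual0 v : dualX phi v -> v (fun=> 0) = 0.
Proof.
move=> Hv; have := dual_linear 1 Hv inCM0_0 inCM0_0.
by rewrite mul1r addr0 => h; lra.
Qed.

Lemma dualD v f g : dualX phi v -> X f -> X g ->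
  v (fun x => f x + g x) = v f + v g.
Proof.
move=> Hv Xf Xg; rewrite -[v f]mul1r -(dual_linear 1 Hv Xf Xg); congr (v _).
by apply/funext => x; rewrite mul1r.
Qed.

Lemma dualZ v f c : dualX phi v -> X f -> v (fun x => c * f x) = c * v f.
Proof.
move=> Hv Xf; have := dual_linear c Hv Xf inCM0_0; rewrite (dual0 Hv) addr0 => <-.
by congr (v _); apply/funext => x; rewrite addr0.
Qed.

Lemma inCM0_scale f c : X f -> X (fun x => c * f x).
Proof.
move=> Xf; have := inCM0_linear c Xf inCM0_0.
by congr (X _); apply/funext => x; rewrite addr0.
Qed.

Lemma dual_cutU v f A B : dualX phi v -> X f -> measurable A -> measurable B ->
  [disjoint A & B] -> v (cut (A `|` B) f) = v (cut A f) + v (cut B f).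
Proof.
move=> Hv Xf mA mB AB; rewrite (cut_setU _ AB).
by apply: (dualD Hv); exact: inCM0_cut.
Qed.

Lemma dual_split v f A : dualX phi v -> X f -> measurable A ->
  v f = v (cut A f) + v (cut (~` A) f).
Proof.
move=> Hv Xf mA; have AC : [disjoint A & ~` A] by apply/disj_setPS => x [].
by rewrite -(dual_cutU Hv Xf mA (measurableC mA) AC) setUv cut_setT.
Qed.

Lemma dual_bounded v : dualX phi v -> exists2 K, 0 <= K &
  forall f P, X f -> prim_bound phi f P -> `|v f| <= K * P.
Proof.
move=> [_ [K HK]]; exists (`|K| * C); first by rewrite mulr_ge0// ltW// C_gt0.
move=> f P Xf fP; apply: le_trans (HK f Xf) _.
apply: (@le_trans _ _ (`|K| * CMnorm phi f)).
  by rewrite ler_wpM2r ?CMnorm_ge0// ler_norm.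
by rewrite -(mulrA `|K|) ler_wpM2l//; exact: CMnorm_le.
Qed.

Lemma dualnorm_fin v : dualX phi v -> dualnorm phi v \is a fin_num.
Proof.
move=> [lin [K HK]]; rewrite ge0_fin_numE.
  apply: (@le_lt_trans _ _ `|K|%:E); last by rewrite ltry.
  apply: ge_ereal_sup => _ [f [Xf f1] <-]; rewrite lee_fin.
  apply: le_trans (HK f Xf) _; apply: (@le_trans _ _ (`|K| * CMnorm phi f)).
    by rewrite ler_wpM2r ?CMnorm_ge0// ler_norm.
  by rewrite ler_piMr.
apply: (@le_trans _ _ (`|v (fun=> 0)|%:E)); first by rewrite lee_fin.
apply: ereal_sup_ubound; exists (fun=> 0) => //; split; first exact: inCM0_0.
have := @CMnorm_le (fun=> 0) 0 inCM0_0; rewrite mulr0 => /(_ _)/le_trans; apply => //.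
move=> t t0; rewrite mul0r /prim /L1; under eq_Rintegral do rewrite normr0.
by rewrite Rintegral_cst ?mul0r ?mulr0//; exact: measurable_I0.
Qed.

(** Divided by C P, the function f falls into the unit ball over which [dualnorm] is a supremum. *)
Lemma dual_le_dualnorm v f P : dualX phi v -> X f -> prim_bound phi f P -> 0 < P ->
  `|v f| <= C * P * fine (dualnorm phi v).
Proof.
move=> Hv Xf fP P0; have CP0 : 0 < C * P by rewrite mulr_gt0 ?C_gt0.
pose g x := (C * P)^-1 * f x.
have Xg : X g by exact: inCM0_scale.
have gP : prim_bound phi g C^-1.
  have := prim_bound_scale (C * P)^-1 Xf fP.
  have E : (C * P)^-1 * P = C^-1 by rewrite (invfM C) divfK// gt_eqF.
  by rewrite ger0_norm ?invr_ge0 ?(ltW CP0)// E.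
have g1 : CMnorm phi g <= 1.
  by apply: le_trans (CMnorm_le Xg gP) _; rewrite divff// gt_eqF// C_gt0.
have vg : (`|v g|%:E <= dualnorm phi v)%E by apply: ereal_sup_ubound; exists g.
move: vg; rewrite -[dualnorm _ _]fineK ?dualnorm_fin// lee_fin /g (dualZ _ Hv Xf) normrM.
by rewrite ger0_norm ?invr_ge0 ?(ltW CP0)// ler_pdivrMl.
Qed.

Lemma prim_boundW f P P' : P <= P' -> prim_bound phi f P -> prim_bound phi f P'.
Proof.
by move=> PP fP t t0; apply: le_trans (fP t t0) _; rewrite ler_pM2r.
Qed.

Lemma wuC_uniform_CM0 (u : nat -> R -> R) (h : nat -> (R -> R) -> R) (K : R) :
  weak0X phi u ->
  (forall j c f g, X f -> X g ->
     h j (fun x => c * f x + g x) = c * h j f + h j g) ->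
  (forall f n, X f -> \sum_(j < n) `|h j f| <= K * CMnorm phi f) ->
  forall e, 0 < e -> exists J, forall i j, (J <= j)%N -> `|h j (u i)| <= e.
Proof.
move=> [Xu u0] hl hK.
apply: (@wuC_uniform R _ (fun c f g x => c * f x + g x) X (CMnorm phi) u h K) => //.
by move=> F Fl FK; apply: u0; split.
Qed.

Lemma wuC_uniform_dual (w : nat -> (R -> R) -> R)
    (F : nat -> ((R -> R) -> R) -> R) (K : R) :
  weak0dual phi w ->
  (forall j c v v', dualX phi v -> dualX phi v' ->
     F j (fun f => c * v f + v' f) = c * F j v + F j v') ->
  (forall v n, dualX phi v ->
     \sum_(j < n) `|F j v| <= K * fine (dualnorm phi v)) ->
  forall e, 0 < e -> exists J, forall i j, (J <= j)%N -> `|F j (w i)| <= e.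
Proof.
move=> [Xw w0] Fl FK.
apply: (@wuC_uniform R _ (fun c v v' f => c * v f + v' f) (dualX phi)
  (fun v => fine (dualnorm phi v)) w F K) => // G Gl [K' GK]; apply: w0; split => //.
exists K' => v Hv; rewrite -[dualnorm _ _]fineK ?dualnorm_fin// -EFinM lee_fin.
exact: GK.
Qed.

Lemma integral_linear_CM0 A t c f g : measurable A -> 0 < t -> A `<=` I0 t ->
  X f -> X g ->
  \int[mu]_(x in A) (c * f x + g x) =
  c * \int[mu]_(x in A) f x + \int[mu]_(x in A) g x.
Proof.
move=> mA t0 At Xf Xg.
have fA := inCM0_integrable Xf mA t0 At; have gA := inCM0_integrable Xg mA t0 At.
rewrite RintegralD// ?RintegralZl//.
rewrite (_ : _ \o _ = (fun x => c%:E * (EFin \o f) x)%E)//.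
exact: integrableZl.
Qed.

Lemma integral_le_L1 A t f : measurable A -> 0 < t -> A `<=` I0 t ->
  X f -> `|\int[mu]_(x in A) f x| <= L1 mu A f.
Proof.
by move=> mA t0 At Xf; apply: le_normr_Rintegral => //; exact: inCM0_integrable At.
Qed.

Lemma L1_le_prim A t f : measurable A -> 0 < t -> A `<=` I0 t -> X f ->
  L1 mu A f <= prim f t.
Proof.
move=> mA t0 At Xf; apply: L1_sub => //; first exact: measurable_I0.
exact: inCM0_locint.
Qed.

End Dual.
End FunctionSpace.

(** * Boundedness of weakly null sequences, and reduction to windows *)

Section Uniformity.
Variables (R : realType) (phi : R -> R) (a r : R).
Hypothesis W : weight phi a r.
Local Notation mu := (@lebesgue_measure R).
Local Notation C := (r * a / (1 - r)).
Local Notation X := (inCM0 phi).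
Implicit Types (f g h : R -> R) (A B : set R) (s t x e P c M : R).

Let phi_gt0 := weight_gt0 W.
Let a1 := weight_a1 W.
Let a0 : 0 < a. Proof. exact: lt_trans ltr01 a1. Qed.

(** If boundedness failed, suitable multiples of integrals over sets [(z j).2] would exceed 1 on
    some [u n]. The factors 2^-(j+2) make these functionals a weakly unconditionally Cauchy series,
    which contradicts uniform convergence to 0. *)
Lemma weak0X_bounded (u : nat -> R -> R) : weak0X phi u ->
  exists b : R, forall n, prim_bound phi (u n) b.
Proof.
move=> u0; have Xu := u0.1; apply/not_existsP => nB.
have H (j : nat) : exists z : nat * R * set R,
    [/\ 0 < z.1.2, measurable z.2, z.2 `<=` I0 z.1.2 &
     2 ^+ j.+2 * z.1.2 < phi z.1.2 * `|\int[mu]_(x in z.2) u z.1.1 x|].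
  (* The extra factor 2 pays for [L1_half]. *)
  have := nB (2 * 2 ^+ j.+2) => /existsNP[n /existsNP[t /not_implyP[t0 /negP]]].
  rewrite -ltNge => h.
  have [B [mB BI hB]] := @L1_half _ _ R mu (I0 t) (u n)
    (@measurable_I0 R t) (inCM0_locint W (Xu n) t0).
  exists (n, t, B); split => //=.
  have := lt_le_trans h (ler_wpM2l (ltW (phi_gt0 t0)) hB).
  by rewrite -mulrA (mulrCA (phi t)) ltr_pM2l.
have {H}[z zP] := choice H.
pose h j f := (2 ^+ j.+2)^-1 * (phi (z j).1.2 / (z j).1.2) * \int[mu]_(x in (z j).2) f x.
have [||J HJ] := @wuC_uniform_CM0 R phi u h (3 / 2) u0 _ _ 1 ltr01.
- move=> j c f g Xf Xg; have [t0 mB BI _] := zP j.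
  by rewrite /h (integral_linear_CM0 W c mB t0 BI Xf Xg); ring.
- move=> f n Xf; rewrite mulrAC; apply: le_trans (sum_geometric_half n _); last first.
    by rewrite mulr_ge0// (CMnorm_ge0 W).
  apply: ler_sum => j _; have [t0 mB BI _] := zP j.
  rewrite /h -mulrA normrM ger0_norm ?invr_ge0 ?exprn_ge0// mulrC ler_pM2r ?invr_gt0 ?exprn_gt0//.
  rewrite normrM ger0_norm ?divr_ge0 ?(ltW t0) ?(ltW (phi_gt0 t0))// mulrAC ler_pdivrMr//.
  apply: le_trans (prim_le_CMnorm W Xf t0); rewrite ler_pM2l ?phi_gt0//.
  apply: le_trans (integral_le_L1 W mB t0 BI Xf) _; exact: (L1_le_prim W).
have [t0 _ _ h1] := zP J; have := HJ (z J).1.1 J (leqnn J).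
rewrite leNgt => /negP; apply; rewrite /h -mulrA normrM.
rewrite (@ger0_norm _ (2 ^+ J.+2)^-1) ?invr_ge0 ?exprn_ge0//.
rewrite mulrC ltr_pdivlMr ?exprn_gt0// mul1r.
rewrite normrM ger0_norm ?divr_ge0 ?(ltW t0) ?(ltW (phi_gt0 t0))//.
by rewrite mulrAC ltr_pdivlMr.
Qed.

(** The same argument one dual higher, with multiples of evaluations at functions of the unit ball
    of the working norm. *)
Lemma weak0dual_bounded (v : nat -> (R -> R) -> R) : weak0dual phi v ->
  exists2 V, 0 <= V & forall n f P, X f -> prim_bound phi f P -> `|v n f| <= V * P.
Proof.
move=> v0; have Xv := v0.1.
have [V HV] : exists V, forall n f, X f -> prim_bound phi f 1 -> `|v n f| <= V.
  apply/not_existsP => nV.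
  have H (j : nat) : exists z : nat * (R -> R),
      [/\ X z.2, prim_bound phi z.2 1 & 2 ^+ j.+2 < `|v z.1 z.2|].
    have := nV (2 ^+ j.+2) => /existsNP[n /existsNP[f]].
    move=> /not_implyP[Xf /not_implyP[fP /negP]]; rewrite -ltNge => h.
    by exists (n, f).
  have {H}[z zP] := choice H.
  pose F j (w : (R -> R) -> R) := (2 ^+ j.+2)^-1 * w (z j).2.
  have [||J HJ] := @wuC_uniform_dual R phi _ _ W v F (C / 2) v0 _ _ 1 ltr01.
  - by move=> j c w w' _ _; rewrite /F; ring.
  - move=> w n Hw; have d0 : 0 <= fine (dualnorm phi w).
      have [Xz zb _] := zP 0%N.
      have := le_trans (normr_ge0 _) (dual_le_dualnorm W Hw Xz zb ltr01).
      by rewrite mulr1 pmulr_rge0// (C_gt0 W).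
    rewrite mulrAC; apply: le_trans (sum_geometric_half n _); last first.
      by rewrite mulr_ge0// ltW// (C_gt0 W).
    apply: ler_sum => j _; have [Xz zb _] := zP j.
    rewrite /F normrM ger0_norm ?invr_ge0 ?exprn_ge0// mulrC ler_pM2r ?invr_gt0 ?exprn_gt0//.
    by have := dual_le_dualnorm W Hw Xz zb ltr01; rewrite mulr1.
  have [_ _ h1] := zP J; have := HJ (z J).1 J (leqnn J).
  rewrite leNgt => /negP; apply.
  rewrite /F normrM ger0_norm ?invr_ge0 ?exprn_ge0//.
  by rewrite mulrC ltr_pdivlMr ?exprn_gt0// mul1r.
exists `|V| => // n f P Xf fP; have P0 := prim_bound_ge0 W fP.
have key Q : 0 < Q -> prim_bound phi f Q -> `|v n f| <= `|V| * Q.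
  move=> Q0 fQ; have Xg := inCM0_scale W Q^-1 Xf.
  have gQ := prim_bound_scale W Q^-1 Xf fQ.
  have := HV n _ Xg; rewrite ger0_norm ?invr_ge0 ?(ltW Q0)// mulVf ?gt_eqF// in gQ.
  move=> /(_ gQ); rewrite (dualZ W)// normrM ger0_norm ?invr_ge0 ?(ltW Q0)//.
  rewrite ler_pdivrMl// mulrC => /le_trans; apply.
  by rewrite ler_wpM2r ?(ltW Q0)// ler_norm.
(* P may be 0, which forbids rescaling by its inverse; P + d is used instead, with d small. *)
apply/ler_addgt0Pr => e e0; pose d := e / (`|V| + 1).
have V0 : 0 < `|V| + 1 by rewrite ltr_wpDl.
have d0 : 0 < d by rewrite divr_gt0.
have Pd : prim_bound phi f (P + d) by apply: (prim_boundW _ fP); rewrite lerDl ltW.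
apply: le_trans (key _ _ Pd) _; first by rewrite ltr_wpDl.
rewrite mulrDr lerD2l /d mulrA ler_pdivrMr// mulrC ler_pM2l//.
by rewrite lerDl.
Qed.

Lemma prim_small f t e : locint f -> 0 < t -> 0 < e ->
  exists n, prim f (t / a ^+ n) <= e.
Proof.
move=> fl t0 e0.
have [del del0 H] := @L1_abs_continuous _ _ R mu (I0 t) f (@measurable_I0 R t) (fl t t0) e e0.
have ai0 : 0 <= a^-1 by rewrite invr_ge0 ltW.
have ai1 : a^-1 < 1 by rewrite invf_lt1.
have [n Hn] := exists_expr_lt ai0 ai1 (divr_gt0 del0 t0).
exists n; have an0 : 0 < a ^+ n by rewrite exprn_gt0.
have tn0 : 0 < t / a ^+ n by rewrite divr_gt0.
apply/ltW/H; first exact: measurable_I0.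
  move=> x /I0P/andP[x0 xt]; apply/I0P; rewrite x0 (le_trans xt)//.
  by rewrite ler_pdivrMr// ler_peMr ?(ltW t0)// exprn_ege1// ltW.
apply: (@le_lt_trans _ _ (t / a ^+ n)%:E); first by rewrite -(mu_I0 tn0).
rewrite lte_fin; move: Hn; by rewrite exprVn ltr_pdivlMr// mulrC.
Qed.

(** The window bound is the recursion for [prim f], whose remainder [prim f (t / a ^+ n)] becomes
    arbitrarily small. Up to the factor 1/(1-r), the norm is thus a supremum over windows, which is
    the c_0 structure in usable form. *)
Lemma window_prim_bound f D : locint f -> 0 <= D ->
  (forall t, 0 < t -> L1 mu `]t / a, t]%classic f <= D * (t / phi t)) ->
  prim_bound phi f (D / (1 - r)).
Proof.
move=> fl D0 H.
have rec t : 0 < t -> prim f t <= prim f (t / a) + D * (t / phi t).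
  move=> t0; apply: le_trans (lerD (lexx _) (H t t0)).
  have E : I0 t = I0 (t / a) `|` `]t / a, t]%classic.
    apply/seteqP; split => x.
      move=> /I0P/andP[x0 xt]; have [h|h] := leP x (t / a).
        by left; apply/I0P; rewrite x0.
      by right; rewrite /= in_itv/= h.
    have ta0 : 0 < t / a by rewrite divr_gt0.
    have tat : t / a <= t by rewrite ler_pdivrMr// ler_peMr// ?ltW.
    move=> [/I0P/andP[x0 xt]|/=]; first by apply/I0P; rewrite x0 (le_trans xt).
    rewrite in_itv/= => /andP[h1 h2]; apply/I0P; rewrite h2 andbT ltW//.
    exact: lt_trans ta0 h1.
  rewrite /prim {1}E L1_setU//; first exact: measurable_I0.
    apply/disj_setPS => x [/I0P/andP[_ h1]] /=; rewrite in_itv/= => /andP[+ _].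
    by rewrite ltNge h1.
  by rewrite -E; exact: fl.
move=> t t0; have pt := phi_gt0 t0.
suff h : prim f t <= D / (1 - r) * (t / phi t).
  apply: (@le_trans _ _ (phi t * (D / (1 - r) * (t / phi t)))); first by rewrite ler_pM2l.
  have r1 : 0 < 1 - r by rewrite subr_gt0 (weight_r1 W).
  by rewrite le_eqVlt; apply/orP; left; apply/eqP; field; rewrite !gt_eqF.
apply/ler_addgt0Pr => e e0; have [n Hn] := prim_small fl t0 e0.
apply: le_trans (weight_recursion W D0 rec n t0) _.
by rewrite addrC lerD2l.
Qed.

(** For t at most 1/M or at least M, [vanishing] applies to f itself. In between the truncated
    function vanishes past 1/M, so its primitive keeps its value at 1/M while phi t / t
    decreases. *)
Lemma tail_prim_bound f e : X f -> 0 < e -> exists2 M0, 1 < M0 &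
  forall M, M0 <= M -> prim_bound phi (cut (~` band M) f) e.
Proof.
move=> /[dup] Xf /(inCM0P W)[mf fl fv] e0; have [tau tau0 [T tT H]] := fv e e0.
have T0 := lt_le_trans tau0 tT.
exists (1 + tau^-1 + T); first by rewrite -addrA ltrDl addr_gt0// invr_gt0.
move=> M hM; have ti0 : 0 < tau^-1 by rewrite invr_gt0.
have M1 : 1 <= M by apply: le_trans hM; lra.
have M0 : 0 < M := lt_le_trans ltr01 M1.
have Mt : M^-1 <= tau by rewrite -[tau]invrK lef_pV2 ?posrE//; lra.
have TM : T <= M by lra.
have Mi0 : 0 < M^-1 by rewrite invr_gt0.
have mQ : measurable (~` band M) by apply: measurableC; exact: measurable_band.
have le1 t : 0 < t -> prim (cut (~` band M) f) t <= prim f t.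
  move=> t0; apply: (@prim_mono R) => //; first exact: measurable_cut_Dom.
  by move=> x _; exact: norm_cut_le.
move=> t t0; have pt := phi_gt0 t0.
have [tM|Mt'] := leP t M^-1.
  apply: le_trans (H t t0 _); first by rewrite ler_pM2l//; exact: le1.
  by left; exact: le_trans Mt.
have [Tt|tT'] := leP M t.
  apply: le_trans (H t t0 _); first by rewrite ler_pM2l//; exact: le1.
  by right; exact: le_trans TM Tt.
have -> : prim (cut (~` band M) f) t = prim (cut (~` band M) f) M^-1.
  have lc : locint (cut (~` band M) f).
    by apply: (locint_dominated fl); [exact: measurable_cut_Dom|move=> x _; exact: norm_cut_le].
  apply/eqP; rewrite eq_le; apply/andP; split; last exact: (prim_le lc (ltW Mt')).
  rewrite /prim L1_cut [leRHS]L1_cut; apply: L1_sub.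
  - by apply: measurableI => //; exact: measurable_I0.
  - by apply: measurableI => //; exact: measurable_I0.
  - move=> x [/I0P/andP[x0 xt] nb]; split => //; apply/I0P; rewrite x0/= leNgt.
    by apply/negP => h; apply: nb; apply/bandP; rewrite (ltW h)/=; lra.
  apply: integrableS (fl _ Mi0) => //; first exact: measurable_I0.
  by apply: measurableI => //; exact: measurable_I0.
have h1 : phi M^-1 * prim (cut (~` band M) f) M^-1 <= e * M^-1.
  apply: le_trans (H _ Mi0 (or_introl Mt)).
  by rewrite ler_pM2l ?phi_gt0//; exact: le1.
have h2 := weight_ratio W Mi0 (ltW Mt').
rewrite -ler_pdivrMr// mulrAC.
apply: (@le_trans _ _ (phi M^-1 / M^-1 * prim (cut (~` band M) f) M^-1)).
  by rewrite ler_wpM2r// prim_ge0.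
by rewrite mulrAC ler_pdivrMr.
Qed.

End Uniformity.

(** * Uniform smallness outside a band, and equi-integrability *)

Section Tails.
Variables (R : realType) (phi : R -> R) (a r : R).
Hypothesis W : weight phi a r.
Local Notation mu := (@lebesgue_measure R).
Local Notation C := (r * a / (1 - r)).
Local Notation X := (inCM0 phi).
Implicit Types (f g h : R -> R) (A B : set R) (s t x e P c M : R).

Let phi_gt0 := weight_gt0 W.
Let a1 := weight_a1 W.
Let a0 : 0 < a. Proof. exact: lt_trans ltr01 a1. Qed.

Lemma dual_tail_small (v : (R -> R) -> R) f e : dualX phi v -> X f -> 0 < e ->
  exists2 M0, 1 < M0 & forall M, M0 <= M -> `|v (cut (~` band M) f)| <= e.
Proof.
move=> Hv Xf e0; have [K K0 HK] := dual_bounded W Hv.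
have K1 : 0 < K + 1 by rewrite ltr_wpDl.
have [M0 M01 H] := tail_prim_bound W Xf (divr_gt0 e0 K1).
exists M0 => // M MM; apply: le_trans (HK _ _ _ (H M MM)) _.
  by apply: (inCM0_cut W Xf); apply: measurableC; exact: measurable_band.
by rewrite mulrA ler_pdivrMr// mulrC ler_pM2l// lerDl.
Qed.

Lemma band_subset M M' : 0 < M -> M <= M' -> band M `<=` band M'.
Proof.
move=> M0 MM x /bandP/andP[h1 h2]; apply/bandP; rewrite (le_trans h2)// andbT.
by apply: le_trans h1; rewrite lef_pV2 ?posrE// (lt_le_trans M0).
Qed.

Lemma measurable_annulus M M' : measurable (band M' `\` band M : set R).
Proof. by apply: measurableD; exact: measurable_band. Qed.

(** A point within a factor a of [band M0'] lies in the band of parameter a M0', hence in [band M1],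
    which the second annulus avoids. *)
Lemma annulus_separated M0 M0' M1 M1' x y : 0 < M0' -> a * M0' <= M1 ->
  (band M0' `\` band M0) x -> (band M1' `\` band M1) y ->
  ~ (x < a * y /\ y < a * x).
Proof.
move=> M00 MM [/bandP/andP[x1 x2] _] [_ nb] [xy yx]; apply: nb; apply/bandP.
have M10 : 0 < M1 by apply: lt_le_trans MM; rewrite mulr_gt0.
apply/andP; split.
  rewrite -(ler_pM2l a0); apply: le_trans (ltW xy); apply: le_trans x1.
  by rewrite ler_pdivrMr// ler_pdivlMl// mulrC.
by apply: le_trans (ltW yx) _; apply: le_trans MM; rewrite ler_pM2l.
Qed.

Section Blocks.
Variables (A : nat -> set R) (f : nat -> R -> R) (c : nat -> R).
Hypothesis mA : forall j, measurable (A j).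
Hypothesis Xf : forall j, X (f j).
Hypothesis fb : forall j, prim_bound phi (f j) 1.
Hypothesis c1 : forall j, `|c j| <= 1.
Hypothesis sep : forall i j x y, (i < j)%N -> A i x -> A j y ->
  ~ (x < a * y /\ y < a * x).

Definition block_sum n x : R := \sum_(j < n) c j * cut (A j) (f j) x.

Lemma block_sumS n :
  block_sum n.+1 = (fun x => c n * cut (A n) (f n) x + block_sum n x).
Proof. by apply/funext => x; rewrite /block_sum big_ord_recr/= addrC. Qed.

Lemma inCM0_block_sum n : X (block_sum n).
Proof.
elim: n => [|n IH].
  rewrite (_ : block_sum 0 = (fun=> 0)); first exact: (inCM0_0 W).
  by apply/funext => x; rewrite /block_sum big_ord0.
by rewrite block_sumS; exact: (inCM0_linear W (c n) (inCM0_cut W (Xf n) (mA n)) IH).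
Qed.

Lemma dual_block_sum (v : (R -> R) -> R) n : dualX phi v ->
  v (block_sum n) = \sum_(j < n) c j * v (cut (A j) (f j)).
Proof.
move=> Hv; elim: n => [|n IH].
  rewrite big_ord0 (_ : block_sum 0 = (fun=> 0)); first exact: (dual0 W Hv).
  by apply/funext => x; rewrite /block_sum big_ord0.
rewrite block_sumS (dual_linear (c n) Hv (inCM0_cut W (Xf n) (mA n)) (inCM0_block_sum n)).
by rewrite IH big_ord_recr/= addrC.
Qed.

(* A window ]t / a, t] meets at most one of the blocks. *)
Lemma block_sum_prim_bound n : prim_bound phi (block_sum n) (1 - r)^-1.
Proof.
rewrite -[(1 - r)^-1]mul1r; apply: (window_prim_bound W) => //.
  exact: (inCM0_locint W (inCM0_block_sum n)).
move=> t t0; rewrite mul1r; set V := `]t / a, t]%classic.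
have VV x y : V x -> V y -> x < a * y.
  rewrite /V /= !in_itv/= => /andP[_ xt] /andP[yt _].
  by apply: le_lt_trans xt _; rewrite mulrC -ltr_pdivrMr.
have mV : measurable (V : set R) by exact: measurable_itv.
have VI : V `<=` I0 t.
  move=> x; rewrite /V/= in_itv/= => /andP[h1 h2]; apply/I0P; rewrite h2 andbT ltW//.
  by apply: lt_trans h1; rewrite divr_gt0.
have [j Hj] : exists j, forall x, V x -> `|block_sum n x| <= `|f j x|.
  have [[j [y [jn Vy Ay]]]|nj] := pselect (exists j y, [/\ (j < n)%N, V y & A j y]).
    exists j => x Vx; rewrite /block_sum (bigD1 (Ordinal jn))//= big1 ?addr0.
      rewrite normrM -[leRHS]mul1r; apply: ler_pM => //; exact: norm_cut_le.
    move=> i; rewrite -val_eqE/= neq_ltn => ij; rewrite cut_out ?mulr0// => Ax.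
    case/orP: ij => ij.
      by apply: (sep ij Ax Ay); split; exact: VV.
    by apply: (sep ij Ay Ax); split; exact: VV.
  exists 0%N => x Vx; rewrite /block_sum big1 ?normr0// => i _.
  by rewrite cut_out ?mulr0// => Ax; apply: nj; exists i, x.
apply: (@le_trans _ _ (L1 mu V (f j))).
  apply: L1_mono => //.
    apply: measurable_fun_Dom => //; first by apply: subset_trans VI _; exact: I0_Dom.
    exact: (inCM0_measurable W (inCM0_block_sum n)).
  exact: (inCM0_integrable W (Xf j) mV t0 VI).
apply: le_trans (L1_le_prim W mV t0 VI (Xf j)) _.
by rewrite ler_pdivlMr ?phi_gt0// mulrC -[leRHS]mul1r; exact: fb.
Qed.

(** With coefficients the signs of v on the blocks, v of the block sum is the sum of the absolute
    values, and the norm of the block sum is bounded independently of n. So evaluations at the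
    blocks form a weakly unconditionally Cauchy series on the dual. *)
Lemma block_wuC (v : (R -> R) -> R) n : dualX phi v ->
  (forall j, c j = Num.sg (v (cut (A j) (f j)))) ->
  \sum_(j < n) `|v (cut (A j) (f j))| <= C * (1 - r)^-1 * fine (dualnorm phi v).
Proof.
move=> Hv cE; have r1 : 0 < (1 - r)^-1 by rewrite invr_gt0 subr_gt0 (weight_r1 W).
have := dual_le_dualnorm W Hv (inCM0_block_sum n) (block_sum_prim_bound n) r1.
apply: le_trans; rewrite (dual_block_sum n Hv).
under [X in _ <= `|X|]eq_bigr do rewrite cE -normrEsg.
exact: ler_norm.
Qed.

End Blocks.

(** If every band fails, each failure can be cut down to an annulus, since one functional is small
    on far tails of one function. Successive annuli are taken a factor a apart, and the evaluations
    on them, all larger than e, contradict [block_wuC]. *)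
Lemma weak0dual_tails (v : nat -> (R -> R) -> R) e : weak0dual phi v -> 0 < e ->
  exists2 M, 1 < M & forall n f, X f -> prim_bound phi f 1 ->
    `|v n (cut (~` band M) f)| <= e.
Proof.
move=> v0 e0; have Xv := v0.1; apply/not_exists2P => nM.
have H (l : seq (R * R * nat * (R -> R))) : exists z : R * R * nat * (R -> R),
    [/\ 1 < z.1.1.2, X z.2, prim_bound phi z.2 1,
     e < `|v z.1.2 (cut (band z.1.1.2 `\` band z.1.1.1) z.2)| &
     forall m, (m < size l)%N -> a * (nth (0, 0, 0%N, cst 0) l m).1.1.2 <= z.1.1.1].
  have [N HN] : exists N, forall i, (N <= i)%N -> forall m, (m < size l)%N ->
      a * (nth (0, 0, 0%N, cst 0) l m).1.1.2 <= i%:R.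
    apply: eventually_bounded_forall => m _.
    set b := a * _; exists (Num.bound `|b|) => i bi.
    apply: le_trans (ler_norm b) _; apply: le_trans (ltW (archi_boundP (normr_ge0 b))) _.
    by rewrite ler_nat.
  (* The shift by 2 gives M > 1; being at least N, M also exceeds a times every earlier outer
     radius. *)
  pose M : R := N.+2%:R; have M1 : 1 < M by rewrite /M ltr1n.
  have M0 : 0 < M := lt_trans ltr01 M1.
  case: (nM M) => // /existsNP[n /existsNP[f]].
  move=> /not_implyP[Xf /not_implyP[fP /negP]]; rewrite -ltNge => he.
  have mQ M' : measurable (~` band M' : set R) by apply: measurableC; exact: measurable_band.
  have d0 : 0 < `|v n (cut (~` band M) f)| - e by rewrite subr_gt0.
  (* Half of the surplus over e may be lost beyond [M2], so the annulus still carries more than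
     e. *)
  pose d := (`|v n (cut (~` band M) f)| - e) / 2; have {}d0 : 0 < d by rewrite divr_gt0.
  have [M' M'1 HM'] := dual_tail_small (Xv n) Xf d0.
  pose M2 := Num.max M M'.
  have MM2 : M <= M2 by rewrite le_max lexx.
  exists (M, M2, n, f) => /=; split => //.
  - exact: lt_le_trans MM2.
  - have E : ~` band M = (band M2 `\` band M) `|` ~` band M2.
      apply/seteqP; split => x.
        by move=> nb; have [|] := pselect (band M2 x); [left|right].
      by move=> [[]//|nb /(band_subset M0 MM2)].
    have := @dual_cutU _ _ _ _ W (v n) f _ _ (Xv n) Xf (measurable_annulus M M2) (mQ M2) _.
    rewrite -E => /(_ _) Ev.
    have := HM' M2; rewrite le_max lexx orbT => /(_ isT) h2.
    have := ler_normD (v n (cut (band M2 `\` band M) f)) (v n (cut (~` band M2) f)).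
    rewrite -Ev; last by apply/disj_setPS => x [[]].
    by move: h2 d0; rewrite /d => h2 d0 h3; lra.
  - move=> m ml; apply: le_trans (HN N (leqnn N) m ml) _.
    by rewrite /M ler_nat; exact: leq_trans (leqnSn _) (leqnSn _).
have [z zP] := seq_choice H.
pose f j := (z j).2; pose A j : set R := band (z j).1.1.2 `\` band (z j).1.1.1.
have Xf j : X (f j) by have [] := zP j.
have fb j : prim_bound phi (f j) 1 by have [] := zP j.
have mA j : measurable (A j) by exact: measurable_annulus.
have sep i j x y : (i < j)%N -> A i x -> A j y -> ~ (x < a * y /\ y < a * x).
  move=> ij; have [_ _ _ _ /(_ i)] := zP j; rewrite size_mkseq => /(_ ij).
  rewrite nth_mkseq// => h; have [M1 _ _ _ _] := zP i.
  exact: (annulus_separated (lt_trans ltr01 M1) h).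
pose F j (w : (R -> R) -> R) := w (cut (A j) (f j)).
have [||J HJ] := @wuC_uniform_dual R phi _ _ W v F (C * (1 - r)^-1) v0 _ _ e e0.
- by [].
- move=> w n Hw; pose c j := Num.sg (w (cut (A j) (f j))).
  apply: (@block_wuC A f c) => // j.
  by rewrite /c; case: sgrP; rewrite ?normr0 ?normrN1 ?normr1.
have [_ _ _ + _] := zP J; rewrite ltNge => /negP; apply; exact: (HJ (z J).1.2 J).
Qed.

Let quarter_lt (e x y z : R) : e < x + y -> y < e / 2 -> x <= 2 * z -> e / 4 < z.
Proof. by move=> *; lra. Qed.

(** A failure gives disjoint sets B_j, each between two members of the sequence E, over which some
    [u n] has an integral larger than e / 4 in absolute value. For any f of the space these
    integrals sum to at most [prim f M], so they form a weakly unconditionally Cauchy series. *)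
Lemma weak0X_equiintegrable (u : nat -> R -> R) M (E : nat -> set R) e :
  weak0X phi u -> 0 < M -> (forall m, measurable (E m)) ->
  (forall m, E m `<=` I0 M) -> (forall m, E m.+1 `<=` E m) ->
  mu (\bigcap_m E m) = 0%E -> 0 < e ->
  exists m, forall n, L1 mu (E m) (u n) <= e.
Proof.
move=> u0 M0 mE EM Ed muE e0; have Xu := u0.1; apply/not_existsP => nE.
have Edm m m' : (m <= m')%N -> E m' `<=` E m.
  elim: m' => [|m' IH]; first by rewrite leqn0 => /eqP ->.
  rewrite leq_eqVlt => /predU1P[->//|/IH h]; exact: subset_trans (Ed m') h.
have iE m f : X f -> mu.-integrable (E m) (EFin \o f).
  by move=> Xf; exact: (inCM0_integrable W Xf (mE m) M0 (EM m)).
have H (l : seq (nat * nat * nat * set R)) : exists z : nat * nat * nat * set R,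
    [/\ measurable z.2, z.2 `<=` E z.1.1.1, (forall x, z.2 x -> ~ E z.1.1.2 x),
     e / 4 < `|\int[mu]_(x in z.2) u z.1.2 x| &
     (z.1.1.1 <= z.1.1.2)%N /\
     forall m, (m < size l)%N -> ((nth (0, 0, 0, set0)%N l m).1.1.2 <= z.1.1.1)%N].
  have [N HN] : exists N, forall i, (N <= i)%N -> forall m, (m < size l)%N ->
      ((nth (0, 0, 0, set0)%N l m).1.1.2 <= i)%N.
    by apply: eventually_bounded_forall => m _; eexists => i; exact.
  have /existsNP[n /negP] := nE N; rewrite -ltNge => he.
  have [del del0 Hdel] := @L1_abs_continuous _ _ R mu (E N) (u n) (mE N)
    (iE N _ (Xu n)) _ (divr_gt0 e0 (ltr0Sn R 1)).
  have [N' HN'] : exists N', forall n, (N' <= n)%N -> (mu (E n) < del%:E)%E.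
    apply: (@measure_decreasing_small _ _ R mu E) => //.
    apply: (@le_lt_trans _ _ (mu (I0 M))); last by rewrite mu_I0// ltry.
    by apply: le_lebesgue_measure => //; exact: measurable_I0.
  pose m' := maxn N N'.
  have Nm' : (N <= m')%N by exact: leq_maxl.
  have mD : measurable (E N `\` E m') by exact: measurableD.
  have small : L1 mu (E m') (u n) < e / 2.
    apply: (Hdel _ (mE m') (Edm _ _ Nm')).
    by apply: HN'; exact: leq_maxr.
  have EE : E N = (E N `\` E m') `|` E m' by rewrite setUC (setDUK (Edm _ _ Nm')).
  have L1E : L1 mu (E N) (u n) = L1 mu (E N `\` E m') (u n) + L1 mu (E m') (u n).
    have dj : [disjoint E N `\` E m' & E m'] by apply/disj_setPS => x [[_ nx]].
    have iU : mu.-integrable ((E N `\` E m') `|` E m') (EFin \o u n).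
      by rewrite -EE; exact: iE.
    by rewrite {1}EE (@L1_setU _ _ R mu _ _ _ mD (mE m') dj iU).
  have iD : mu.-integrable (E N `\` E m') (EFin \o u n).
    by apply: (@integrableS _ _ R mu (E N) _ _ (mE N) mD _ (iE N _ (Xu n))) => x [].
  have [B [mB BD hB]] := @L1_half _ _ R mu _ _ mD iD.
  exists (N, m', n, B); split => //=.
  - by move=> x /BD[].
  - by move=> x /BD[].
  (* Less than e / 2 is lost on [E m'], and a further factor 2 in [L1_half]. *)
  - by apply: quarter_lt small hB; rewrite -L1E.
  - by split=> // m ml; apply: HN.
have [z zP] := seq_choice H.
pose h j f := \int[mu]_(x in (z j).2) f x.
have BM j : (z j).2 `<=` I0 M.
  by have [_ + _ _ _] := zP j => /subset_trans; apply; exact: EM.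
have zlt i j : (i < j)%N -> ((z i).1.1.2 <= (z j).1.1.1)%N.
  by move=> ij; have [_ _ _ _ [_ /(_ i)]] := zP j; rewrite size_mkseq nth_mkseq// => /(_ ij).
have e40 : 0 < e / 4 by rewrite divr_gt0.
have [||J HJ] := @wuC_uniform_CM0 R phi u h (3 * (M / phi M)) u0 _ _ _ e40.
- move=> j c f g Xf Xg; have [mB _ _ _ _] := zP j.
  by rewrite /h (integral_linear_CM0 W c mB M0 (BM j) Xf Xg).
- move=> f n Xf.
  (* The set [E (z k).1.1.1], which contains all later pieces, is carried along as a remainder to
     make the induction work. *)
  have key k : \sum_(j < k) L1 mu (z j).2 f + L1 mu (E (z k).1.1.1) f <= prim f M.
    elim: k => [|k IH]; first by rewrite big_ord0 add0r; exact: (L1_le_prim W).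
    apply: le_trans IH; rewrite big_ord_recr/= -addrA lerD2l.
    have [mB BE BE' _ [zk _]] := zP k; have hk := Edm _ _ (zlt k k.+1 (ltnSn k)).
    have sub : (z k).2 `|` E (z k.+1).1.1.1 `<=` E (z k).1.1.1.
      move=> x [/BE//|]; apply: Edm.
      by apply: leq_trans zk _; exact: zlt.
    have mU : measurable ((z k).2 `|` E (z k.+1).1.1.1) by exact: measurableU.
    have dj : [disjoint (z k).2 & E (z k.+1).1.1.1].
      by apply/disj_setPS => x [/BE' nx /hk].
    have iU := @integrableS _ _ R mu _ _ _ (mE _) mU sub (iE _ _ Xf).
    rewrite -(@L1_setU _ _ R mu _ _ _ mB (mE _) dj iU).
    exact: (@L1_sub _ _ R mu _ _ _ mU (mE _) sub (iE _ _ Xf)).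
  have p1 : prim f M <= 3 * (M / phi M) * CMnorm phi f.
    have := prim_le_CMnorm W Xf M0; rewrite -ler_pdivlMl ?phi_gt0// => /le_trans; apply.
    by rewrite le_eqVlt; apply/orP; left; apply/eqP; ring.
  apply: le_trans p1; apply: le_trans (key n).
  rewrite -[leLHS]addr0; apply: lerD; last exact: L1_ge0.
  apply: ler_sum => j _; have [mB _ _ _ _] := zP j.
  exact: (integral_le_L1 W mB M0 (BM j) Xf).
have [_ _ _ + _] := zP J; rewrite ltNge => /negP; apply; exact: (HJ (z J).1.2 J).
Qed.

End Tails.

(** * Functionals on a band as signed measures *)

Section BandBounds.
Variables (R : realType) (phi : R -> R) (a r : R).
Hypothesis W : weight phi a r.
Local Notation mu := (@lebesgue_measure R).
Local Notation X := (inCM0 phi).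
Implicit Types (f g h : R -> R) (A B G : set R) (s t x e P c M : R).

Let phi_gt0 := weight_gt0 W.

(** On a band the norm is dominated by the L^1 norm: the primitive is 0 before 1/M, and afterwards
    phi t / t is at most its value phi(1/M) M at 1/M. *)
Lemma band_prim_bound f M A : X f -> 0 < M -> measurable A -> A `<=` band M ->
  prim_bound phi (cut A f) (phi M^-1 * M * L1 mu A f).
Proof.
move=> Xf M0 mA AM t t0; have Mi0 : 0 < M^-1 by rewrite invr_gt0.
have L0 := @L1_ge0 _ _ R mu A f.
rewrite /prim L1_cut; have [tM|Mt] := ltP t M^-1.
  rewrite (_ : I0 t `&` A = set0); last first.
    apply/seteqP; split => // x [/I0P/andP[_ xt] /AM/bandP/andP[Mx _]].
    by have := lt_le_trans tM (le_trans Mx xt); rewrite ltxx.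
  rewrite /L1 Rintegral_set0 mulr0; apply: mulr_ge0; last exact: ltW.
  by rewrite mulr_ge0// mulr_ge0 ?(ltW M0)// ltW// phi_gt0.
rewrite -ler_pdivrMr// mulrAC; apply: ler_pM.
- by rewrite divr_ge0 ?(ltW t0)// ltW// phi_gt0.
- exact: L1_ge0.
- by have := weight_ratio W Mi0 Mt; rewrite invrK.
- apply: (@L1_sub _ _ R mu) => //.
  + by apply: measurableI => //; exact: measurable_I0.
  + apply: (inCM0_integrable W Xf mA M0); apply: subset_trans AM _; exact: band_I0.
Qed.

Definition bunit M : R -> R := \1_(band M).

Definition bmeas M A : R := fine (mu (A `&` band M)).

Lemma inCM0_bunit M : 0 < M -> X (bunit M).
Proof. by move=> M0; apply: (inCM0_indic W M0) => //; exact: measurable_band. Qed.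

Lemma measurable_Iband M A : measurable A -> measurable (A `&` band M).
Proof. by move=> mA; apply: measurableI => //; exact: measurable_band. Qed.

Lemma cut_bunit M A : cut A (bunit M) = cut (A `&` band M) (bunit M).
Proof.
apply/funext => x; have [Ax|nA] := pselect (A x); last first.
  by rewrite !cut_out// => -[].
have [Qx|nQ] := pselect (band M x); first by rewrite !cut_in.
by rewrite cut_in// cut_out ?/bunit ?indicE ?memNset// => -[].
Qed.

Lemma L1_bunit M A : measurable A -> L1 mu (A `&` band M) (bunit M) = bmeas M A.
Proof.
move=> mA; have mI := measurable_Iband M mA.
by rewrite /bunit L1_indic// -setIA setIid L1_one.
Qed.

Lemma bmeas_ge0 M A : 0 <= bmeas M A.
Proof. by rewrite fine_ge0. Qed.

Lemma fin_bmeas M A : 0 < M -> measurable A -> mu (A `&` band M) \is a fin_num.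
Proof.
move=> M0 mA; apply: (mu_band_fin M0); first exact: measurable_Iband.
exact: subIsetr.
Qed.

Lemma bmeasU M A B : 0 < M -> measurable A -> measurable B -> [disjoint A & B] ->
  bmeas M (A `|` B) = bmeas M A + bmeas M B.
Proof.
move=> M0 mA mB /disj_setPS AB; rewrite /bmeas setIUl measureU.
- by rewrite fineD// fin_bmeas.
- exact: measurable_Iband.
- exact: measurable_Iband.
- by apply/seteqP; split => // x [[Ax _] [Bx _]]; exact: (AB x).
Qed.

Lemma bunit_prim_bound M A : 0 < M -> measurable A ->
  prim_bound phi (cut A (bunit M)) (phi M^-1 * M * bmeas M A).
Proof.
move=> M0 mA; rewrite cut_bunit -L1_bunit//.
by apply: band_prim_bound => //; [exact: inCM0_bunit|exact: measurable_Iband].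
Qed.

Section Level.
Variables (v : (R -> R) -> R) (M e : R).
Hypothesis Hv : dualX phi v.
Hypothesis M0 : 0 < M.

Let Xe := inCM0_bunit M0.

(** The signed measure whose density would be that of v on the band minus e, so its positive sets
    are the superlevel sets of the density of v. *)
Definition excess (A : set R) : R :=
  v (cut A (bunit M)) - e * bmeas M A.

Lemma excess0 : excess set0 = 0.
Proof.
rewrite /excess (_ : cut set0 (bunit M) = (fun=> 0)); last first.
  by apply/funext => x; rewrite cut_out.
by rewrite (dual0 W Hv) /bmeas set0I measure0 mulr0 subrr.
Qed.

Lemma excessU A B : measurable A -> measurable B -> [disjoint A & B] ->
  excess (A `|` B) = excess A + excess B.
Proof.
move=> mA mB AB; rewrite /excess (dual_cutU W Hv Xe mA mB AB) (bmeasU M0 mA mB AB).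
by ring.
Qed.

(** Domination by the finite measure of the band is what turns finite additivity into countable
    additivity. *)
Lemma excess_bounded : exists2 K, 0 <= K &
  forall A, measurable A -> `|excess A| <= K * bmeas M A.
Proof.
have [K K0 HK] := dual_bounded W Hv.
have pM : 0 <= phi M^-1 * M by rewrite mulr_ge0 ?(ltW M0)// ltW// phi_gt0// invr_gt0.
exists (K * (phi M^-1 * M) + `|e|); first by rewrite addr_ge0// mulr_ge0.
move=> A mA; apply: le_trans (ler_normB _ _) _; rewrite mulrDl; apply: lerD.
  rewrite -mulrA; apply: HK; last exact: bunit_prim_bound.
  exact: (inCM0_cut W).
by rewrite normrM (ger0_norm (bmeas_ge0 _ _)).
Qed.

Definition excess_charge (A : set (measurableTypeR R)) : \bar R := (excess A)%:E.

(** The error after n terms is the excess of the tail union [T n], which decreases to the empty set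
    and so has small measure in the band. *)
Lemma excess_sigma_additive : semi_sigma_additive excess_charge.
Proof.
move=> F mF tF mU; pose U n := \bigcup_(i in `I_n) F i.
have mUn n : measurable (U n) by exact: bigcup_measurable.
have US n : U n.+1 = U n `|` F n.
  apply/seteqP; split => x.
    move=> [i /=]; rewrite ltnS leq_eqVlt => /predU1P[->|ltin] Fx; first by right.
    by left; exists i.
  by move=> [[i /= ltin Fx]|Fx]; [exists i => //=; exact: ltnW|exists n => /=].
have sumE n : (\sum_(0 <= i < n) excess_charge (F i) = (excess (U n))%:E)%E.
  elim: n => [|n IH].
    by rewrite big_geq// (_ : U 0%N = set0) ?excess0//; apply/seteqP; split => // x [].
  have dj : [disjoint U n & F n].
    apply/disj_setPS => x [[i /= ltin Fix] Fnx].
    have /trivIsetP/(_ i n I I) := tF; rewrite neq_ltn ltin => /(_ isT) /seteqP[h _].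
    exact: (h x).
  by rewrite big_nat_recr//= IH /excess_charge US (excessU (mUn n) (mF n) dj) EFinD.
under eq_fun do rewrite sumE.
have [K K0 HK] := excess_bounded.
pose T n := (\bigcup_n F n) `\` U n.
have mT n : measurable (T n) by exact: measurableD.
have UT n : \bigcup_n F n = U n `|` T n.
  by rewrite /T setDUK// => x [i _ Fx]; exists i.
have diff n : excess (\bigcup_n F n) - excess (U n) = excess (T n).
  have dj : [disjoint U n & T n] by apply/disj_setPS => x [Ux [_]]; exact.
  by rewrite {1}(UT n) (excessU (mUn n) (mT n) dj) addrC addKr.
suff : (fun n => excess (U n)) @ \oo --> excess (\bigcup_n F n).
  by move=> h; apply: cvg_EFin => //; exact: nearW.
apply/cvgrPdist_le => d d0; have K1 : 0 < K + 1 by rewrite ltr_wpDl.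
have [N HN] : exists N, forall n, (N <= n)%N -> (mu (T n `&` band M) < (d / (K + 1))%:E)%E.
  apply: (@measure_decreasing_small _ _ R mu (fun n => T n `&` band M)).
  - by have := fin_bmeas M0 (mT 0%N); rewrite ge0_fin_numE.
  - by move=> n; exact: (measurable_Iband M (mT n)).
  - move=> n x [[Fx nU] Qx]; split => //; split => // Ux; apply: nU.
    by rewrite US; left.
  - rewrite (_ : \bigcap_n _ = set0) ?measure0//; apply/seteqP; split => // x Hx.
    have [[[i _ Fx] _] _] := Hx 0%N I.
    by have [[_ nU] _] := Hx i.+1 I; apply: nU; exists i => /=.
  - by rewrite divr_gt0.
exists N => // n /= Nn; rewrite diff; apply: le_trans (HK _ (mT n)) _.
have h : bmeas M (T n) <= d / (K + 1).
  rewrite -lee_fin fineK; last exact: (fin_bmeas M0 (mT n)).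
  by apply: ltW; exact: HN.
apply: le_trans (ler_wpM2l K0 h) _.
by rewrite mulrA ler_pdivrMr// mulrC ler_pM2l// lerDl.
Qed.

HB.instance Definition _ := isCharge.Build _ (measurableTypeR R) R excess_charge
  (congr1 EFin excess0) (fun A _ => isT) excess_sigma_additive.

(** P, the positive Hahn set of [excess_charge], plays the role of the set where the density of v is
    at least e. *)
Lemma hahn_level : exists P : set R, [/\ measurable P,
  (forall A, measurable A -> A `<=` P -> e * bmeas M A <= v (cut A (bunit M))) &
  (forall A, measurable A -> A `<=` ~` P -> v (cut A (bunit M)) <= e * bmeas M A)].
Proof.
have [P [N [[mP posP] [mN negN] PN PN0]]] := Hahn_decomposition excess_charge.
exists P; split => //.
  by move=> A mA AP; have := posP A mA AP; rewrite /= lee_fin subr_ge0.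
move=> A mA AP; have := negN A mA; rewrite /= lee_fin subr_le0; apply.
move=> x Ax; have : [set: measurableTypeR R] x by []; rewrite -PN => -[Px|//].
by have := AP x Ax.
Qed.

End Level.
End BandBounds.

(** * From indicators to functions: bounds off the level sets *)

Section LevelSets.
Variables (R : realType) (phi : R -> R) (a r : R).
Hypothesis W : weight phi a r.
Local Notation mu := (@lebesgue_measure R).
Local Notation C := (r * a / (1 - r)).
Local Notation X := (inCM0 phi).
Implicit Types (f g h : R -> R) (A B : set R) (s t x P c : R).

Let phi_gt0 := weight_gt0 W.

Let half_up (y : R) : y <= 1 -> 2^-1 <= y -> 0 <= 2 * y + -1 * 1 <= 1.
Proof. by move=> *; apply/andP; split; lra. Qed.

Let half_down (y : R) : 0 <= y -> y < 2^-1 -> 0 <= 2 * y <= 1.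
Proof. by move=> *; apply/andP; split; lra. Qed.

Lemma dual_scale (v : (R -> R) -> R) c : dualX phi v -> dualX phi (fun f => c * v f).
Proof.
move=> [lin [K HK]]; split; first by move=> b f g Xf Xg; rewrite lin//; ring.
exists (`|c| * K) => f Xf; rewrite normrM -mulrA ler_wpM2l//; exact: HK.
Qed.

Section OneSided.
Variables (v : (R -> R) -> R) (M e : R) (G : set R).
Hypothesis Hv : dualX phi v.
Hypothesis M0 : 0 < M.
Hypothesis e0 : 0 <= e.
Hypothesis mG : measurable G.
Hypothesis HG : forall A, measurable A -> A `<=` G ->
  v (cut A (bunit M)) <= e * bmeas M A.

Local Notation Q := (band M).

Let Xe : X (bunit M). Proof. exact: (inCM0_bunit W M0). Qed.
Let mQ : measurable (Q : set R). Proof. exact: measurable_band. Qed.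
Let mGQ : measurable (G `&` Q). Proof. exact: measurableI. Qed.
Let QI : Q `<=` I0 M. Proof. exact: band_I0. Qed.
Let GQI : G `&` Q `<=` I0 M. Proof. by move=> x [_ /QI]. Qed.

Let mfQ f : X f -> measurable_fun Q f.
Proof.
move=> Xf; apply: measurable_fun_Dom (inCM0_measurable W Xf) => //.
by apply: subset_trans QI _; exact: I0_Dom.
Qed.

Let mlevel f (I : interval R) : X f -> measurable (Q `&` f @^-1` [set` I]).
Proof. by move=> Xf; apply: (mfQ Xf) => //; exact: measurable_itv. Qed.

Let bunit1 x : Q x -> bunit M x = 1.
Proof. by move=> Qx; rewrite /bunit indicE mem_set. Qed.

(* On [0, 1]-valued f, write f = (1_B + f') / 2 with B = {f >= 1/2} and f' again
   [0, 1]-valued: each step halves the defect of the inequality. *)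
Lemma level_unit_defect : exists K0, forall n f, X f ->
  (forall x, Q x -> 0 <= f x <= 1) ->
  v (cut (G `&` Q) f) <= e * \int[mu]_(x in G `&` Q) f x + K0 / 2 ^+ n.
Proof.
have [K K_ge0 HK] := dual_bounded W Hv.
pose c := phi M^-1 * M.
have c0 : 0 <= c by rewrite /c mulr_ge0 ?(ltW M0)// ltW// phi_gt0// invr_gt0.
exists (K * (c * bmeas M G)); elim=> [|n IH] f Xf f01.
  rewrite expr0 divr1; apply: le_trans (ler_norm _) _.
  apply: (@le_trans _ _ (K * (c * L1 mu (G `&` Q) f))).
    apply: HK; first exact: (inCM0_cut W).
    by apply: (band_prim_bound W) => // x [].
  have h1 : K * (c * L1 mu (G `&` Q) f) <= K * (c * bmeas M G).
    rewrite ler_wpM2l// ler_wpM2l// -(L1_bunit M mG).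
    apply: (@L1_mono _ _ R mu) => //.
    - by apply: measurable_funS (mfQ Xf) => // x [].
    - move=> x [_ Qx]; rewrite bunit1// normr1; have /andP[h0 h1] := f01 x Qx.
      by rewrite ger0_norm.
    - exact: (inCM0_integrable W Xe mGQ M0 GQI).
  apply: le_trans h1 _; rewrite lerDr mulr_ge0//.
  by apply: Rintegral_ge0 => x [_ /f01/andP[]].
pose B := Q `&` f @^-1` `[2^-1, +oo[%classic.
have mB : measurable B by exact: mlevel.
have mGB : measurable (G `&` B) by exact: measurableI.
pose g x := -1 * cut B (bunit M) x.
have XB : X (cut B (bunit M)) by exact: (inCM0_cut W).
have Xg : X g by exact: (inCM0_scale W).
pose f' x := 2 * f x + g x.
have Xf' : X f' by exact: (inCM0_linear W 2 Xf Xg).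
have f'01 x : Q x -> 0 <= f' x <= 1.
  move=> Qx; have /andP[h0 h1] := f01 x Qx; rewrite /f' /g.
  have [Bx|nB] := pselect (B x).
    rewrite cut_in// bunit1//; move: Bx => [_]; rewrite /= in_itv/= andbT => h2.
    exact: half_up.
  rewrite cut_out// mulr0 addr0.
  have h2 : f x < 2^-1.
    by rewrite ltNge; apply/negP => h2; apply: nB; split => //=; rewrite in_itv/= h2.
  exact: half_down.
have decomp : cut (G `&` Q) f =
    (fun x => 2^-1 * cut (G `&` B) (bunit M) x + 2^-1 * cut (G `&` Q) f' x).
  apply/funext => x.
  have [/[dup] GQx [Gx Qx]|nGQ] := pselect ((G `&` Q) x); last first.
    rewrite !(cut_out _ nGQ) cut_out ?mulr0 ?addr0// => -[Gx [Qx _]].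
    exact: nGQ.
  rewrite !(cut_in _ GQx) /f' /g.
  have [Bx|nB] := pselect (B x); first by rewrite !cut_in//; field.
  by rewrite !cut_out//; [field|case].
have Xh1 : X (cut (G `&` B) (bunit M)) by exact: (inCM0_cut W).
have Xh2 : X (cut (G `&` Q) f') by exact: (inCM0_cut W).
have Xh3 := inCM0_scale W 2^-1 Xh2.
have vdec : v (cut (G `&` Q) f) =
    2^-1 * v (cut (G `&` B) (bunit M)) + 2^-1 * v (cut (G `&` Q) f').
  by rewrite decomp (dual_linear 2^-1 Hv Xh1 Xh3) (dualZ W 2^-1 Hv Xh2).
have intB : \int[mu]_(x in G `&` Q) cut B (bunit M) x = bmeas M (G `&` B).
  rewrite -(L1_bunit M mGB) setIAC -L1_cut; apply: eq_Rintegral => x _.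
  by rewrite ger0_norm// /cut mulr_ge0.
have intf : \int[mu]_(x in G `&` Q) f' x =
    2 * \int[mu]_(x in G `&` Q) f x - bmeas M (G `&` B).
  rewrite (integral_linear_CM0 W 2 mGQ M0 GQI Xf Xg); congr (_ + _).
  rewrite RintegralZl//; first by rewrite mulN1r intB.
  exact: (inCM0_integrable W XB mGQ M0 GQI).
have h1 := HG mGB (@subIsetl _ G B); have h2 := IH f' Xf' f'01.
rewrite vdec; rewrite intf in h2.
have -> : e * \int[mu]_(x in G `&` Q) f x + K * (c * bmeas M G) / 2 ^+ n.+1 =
    2^-1 * (e * bmeas M (G `&` B)) +
    2^-1 * (e * (2 * \int[mu]_(x in G `&` Q) f x - bmeas M (G `&` B)) +
            K * (c * bmeas M G) / 2 ^+ n).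
  by rewrite exprS invfM; field; rewrite expf_neq0.
by apply: lerD; rewrite ler_wpM2l// invr_ge0.
Qed.

(** The defect vanishes as n grows, and homogeneity passes from the range [0, 1] to [0, b]. *)
Lemma level_bounded f b : X f -> 0 < b -> (forall x, Q x -> 0 <= f x <= b) ->
  v (cut (G `&` Q) f) <= e * \int[mu]_(x in G `&` Q) f x.
Proof.
have [K0 HK0] := level_unit_defect.
have key g : X g -> (forall x, Q x -> 0 <= g x <= 1) ->
    v (cut (G `&` Q) g) <= e * \int[mu]_(x in G `&` Q) g x.
  move=> Xg g01; apply/ler_addgt0Pr => d d0.
  have K1 : 0 < `|K0| + 1 by rewrite ltr_wpDl.
  have i0 : 0 <= 2^-1 :> R by rewrite invr_ge0.
  have i1 : 2^-1 < 1 :> R by rewrite invf_lt1// ltr1n.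
  have [n Hn] := exists_expr_lt i0 i1 (divr_gt0 d0 K1).
  apply: le_trans (HK0 n g Xg g01) _; rewrite lerD2l.
  apply: (@le_trans _ _ ((`|K0| + 1) / 2 ^+ n)).
    by rewrite ler_wpM2r ?invr_ge0 ?exprn_ge0// (le_trans (ler_norm _))// lerDl.
  by move: Hn; rewrite exprVn ltr_pdivlMr// mulrC => /ltW.
move=> Xf b0 f0b; have Xg := inCM0_scale W b^-1 Xf.
have := key _ Xg; rewrite (_ : cut _ (fun x => b^-1 * f x) =
    (fun x => b^-1 * cut (G `&` Q) f x)); last first.
  by apply/funext => x; rewrite /cut mulrA.
rewrite (dualZ W b^-1 Hv (inCM0_cut W Xf mGQ)).
rewrite RintegralZl//; last exact: (inCM0_integrable W Xf mGQ M0 GQI).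
rewrite mulrCA ler_pM2l ?invr_gt0//; apply => x /f0b/andP[h0 h1].
by rewrite mulr_ge0 ?invr_ge0 ?(ltW b0)//= ler_pdivrMl// mulr1.
Qed.

(** Truncation at a height N: below it [level_bounded] applies, and the part of f above it has so
    small an L^1 norm that v contributes at most d. *)
Lemma level_nonneg f : X f -> (forall x, Q x -> 0 <= f x) ->
  v (cut (G `&` Q) f) <= e * L1 mu Q f.
Proof.
move=> Xf f0; have [K K_ge0 HK] := dual_bounded W Hv.
pose c := phi M^-1 * M.
have c0 : 0 <= c by rewrite /c mulr_ge0 ?(ltW M0)// ltW// phi_gt0// invr_gt0.
pose A n := Q `&` f @^-1` `]n%:R, +oo[%classic.
have mA n : measurable (A n) by exact: mlevel.
have AQ n : A n `<=` Q by move=> x [].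
have iQ : mu.-integrable Q (EFin \o f) by exact: (inCM0_integrable W Xf mQ M0 QI).
apply/ler_addgt0Pr => d d0.
have Kc1 : 0 < K * c + 1 by rewrite ltr_wpDl// mulr_ge0.
have [del del0 Hdel] := @L1_abs_continuous _ _ R mu Q f mQ iQ _ (divr_gt0 d0 Kc1).
have [N HN] : exists N, forall n, (N <= n)%N -> (mu (A n) < del%:E)%E.
  apply: (@measure_decreasing_small _ _ R mu A) => //.
  - by have := mu_band_fin M0 (mA 0%N) (AQ 0%N); rewrite ge0_fin_numE.
  - move=> n x [Qx]; rewrite /A /= !in_itv/= !andbT => h; split => //=.
    by rewrite (le_lt_trans _ h)// ler_nat.
  - rewrite (_ : \bigcap_n _ = set0) ?measure0//; apply/seteqP; split => // x Hx.
    have [_] := Hx (Num.bound `|f x|) I; rewrite /= in_itv/= andbT.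
    by apply/negP; rewrite -leNgt (le_trans (ler_norm _))// ltW// archi_boundP.
pose B := A N; have mB : measurable B := mA N.
have mBC := measurableC mB.
have Xc := inCM0_cut W Xf mGQ.
have XC := inCM0_cut W Xf mBC.
rewrite (dual_split W Hv Xc mB) addrC.
have E1 : cut (~` B) (cut (G `&` Q) f) = cut (G `&` Q) (cut (~` B) f).
  by rewrite !cutI setIC.
have N0 : 0 < N.+1%:R :> R by [].
have h1 : v (cut (~` B) (cut (G `&` Q) f)) <= e * L1 mu Q f.
  rewrite E1; apply: le_trans (level_bounded XC N0 _) _.
    move=> x Qx; have [Bx|nB] := pselect (B x).
      by rewrite cut_out ?lexx//=; exact.
    rewrite cut_in// f0//=; rewrite leNgt; apply/negP => h; apply: nB; split => //=.
    by rewrite in_itv/= andbT (le_lt_trans _ h)// ler_nat.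
  rewrite ler_wpM2l//; apply: le_trans (ler_norm _) _.
  apply: le_trans (integral_le_L1 W mGQ M0 GQI XC) _.
  apply: (@le_trans _ _ (L1 mu (G `&` Q) f)).
    apply: (@L1_mono _ _ R mu) => //.
    - apply: measurable_funS (mfQ XC) => // x [] //.
    - by move=> x _; exact: norm_cut_le.
    - exact: (inCM0_integrable W Xf mGQ M0 GQI).
  by apply: (@L1_sub _ _ R mu) => // x [].
have h2 : v (cut B (cut (G `&` Q) f)) <= d.
  have mBGQ : measurable (B `&` (G `&` Q)) by exact: measurableI.
  rewrite cutI; apply: le_trans (ler_norm _) _.
  have XB : X (cut (B `&` (G `&` Q)) f) by exact: (inCM0_cut W).
  have pb := band_prim_bound W Xf M0 mBGQ (_ : B `&` (G `&` Q) `<=` Q).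
  apply: le_trans (HK _ _ XB (pb _)) _; first by move=> x [_ []].
  have : L1 mu (B `&` (G `&` Q)) f < d / (K * c + 1).
    apply: (Hdel _ mBGQ); first by move=> x [_ []].
    apply: le_lt_trans (HN N (leqnn N)).
    by apply: le_lebesgue_measure => // x [].
  move=> /ltW h; rewrite -/c mulrA.
  apply: (@le_trans _ _ (K * c * (d / (K * c + 1)))).
    by rewrite ler_wpM2l// mulr_ge0.
  by rewrite mulrA ler_pdivrMr// mulrC ler_pM2l// lerDl.
exact: lerD.
Qed.

End OneSided.

(** The one-sided bound is applied to v and to -v, and to the positive and negative parts of f; the
    two parts account for the factor 2. The second premise is written with [-1 * v] to match
    [dual_scale]. *)
Lemma level_abs (v : (R -> R) -> R) (M e : R) (G : set R) f :
  dualX phi v -> 0 < M -> 0 <= e -> measurable G ->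
  (forall A, measurable A -> A `<=` G -> v (cut A (bunit M)) <= e * bmeas M A) ->
  (forall A, measurable A -> A `<=` G -> -1 * v (cut A (bunit M)) <= e * bmeas M A) ->
  X f -> `|v (cut (G `&` band M) f)| <= 2 * e * L1 mu (band M) f.
Proof.
move=> Hv M0 e0 mG H1 H2 Xf.
have mQ : measurable (band M) by exact: measurable_band.
have mGQ : measurable (G `&` band M) by exact: measurableI.
have QI : band M `<=` I0 M by exact: band_I0.
have mfQ g : X g -> measurable_fun (band M) g.
  move=> Xg; apply: measurable_fun_Dom (inCM0_measurable W Xg) => //.
  by apply: subset_trans QI _; exact: I0_Dom.
have nonneg g : X g -> (forall x, band M x -> 0 <= g x) ->
    `|v (cut (G `&` band M) g)| <= e * L1 mu (band M) g.
  move=> Xg g0; rewrite ler_norml; apply/andP; split; last exact: level_nonneg.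
  rewrite lerNl -mulN1r.
  exact: (level_nonneg (dual_scale (-1) Hv) M0 e0 mG H2 Xg g0).
pose B := band M `&` f @^-1` `[0, +oo[%classic.
have mB : measurable B by apply: (mfQ f Xf) => //; exact: measurable_itv.
have mN : measurable (~` B) by exact: measurableC.
have Xp := inCM0_cut W Xf mB; have Xn := inCM0_cut W Xf mN.
have Xn' := inCM0_scale W (-1) Xn.
have Xc := inCM0_cut W Xf mGQ.
have iQ := inCM0_integrable W Xf mQ M0 QI.
rewrite (dual_split W Hv Xc mB); apply: le_trans (ler_normD _ _) _.
have leL g : X g -> (forall x, `|g x| <= `|f x|) -> e * L1 mu (band M) g <= e * L1 mu (band M) f.
  move=> Xg gf; rewrite ler_wpM2l//; apply: (@L1_mono _ _ R mu) => //.
  exact: mfQ.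
rewrite -mulrA mulr_natl mulr2n; apply: lerD.
  rewrite cutI setIC -cutI; apply: le_trans (leL _ Xp _); last by move=> x; exact: norm_cut_le.
  apply: nonneg => // x Qx; have [Bx|nB] := pselect (B x); last by rewrite cut_out.
  by rewrite cut_in//; move: Bx => [_]; rewrite /= in_itv/= andbT.
rewrite cutI setIC -cutI; apply: le_trans (leL _ Xn' _); last first.
  by move=> x; rewrite mulN1r normrN; exact: norm_cut_le.
have -> : `|v (cut (G `&` band M) (cut (~` B) f))| =
    `|v (cut (G `&` band M) (fun x => -1 * cut (~` B) f x))|.
  rewrite (_ : cut (G `&` band M) (fun x => -1 * cut (~` B) f x) =
      (fun x => -1 * cut (G `&` band M) (cut (~` B) f) x)).
    by rewrite (dualZ W (-1) Hv (inCM0_cut W Xn mGQ)) normrM normrN1 mul1r.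
  by apply/funext => x; rewrite /cut; ring.
apply: (nonneg _ Xn') => x Qx; have [Bx|nB] := pselect (B x).
  by rewrite cut_out ?mulr0//; exact.
rewrite cut_in// mulN1r oppr_ge0 leNgt; apply/negP => h; apply: nB; split => //=.
by rewrite in_itv/= andbT ltW.
Qed.

End LevelSets.

(** * Superlevel sets along a weakly null sequence of functionals *)

(** Compactness of [-b, b] gives a cluster point, and an ultrafilter converges to each of its
    cluster points. *)
Lemma bounded_ultra_cvg (R : realType) (U : set_system nat) (x : nat -> R) (b : R) :
  UltraFilter U -> (forall k, `|x k| <= b) -> cvg (x @ U).
Proof.
move=> UU xb; pose I : set R := `[- b, b]%classic.
have FI : (x @ U) I.
  by apply: nearW => k; rewrite /I/= in_itv/= -ler_norml.
have [p [_ cp]] := @segment_compact R (- b) b (x @ U) _ FI.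
apply/cvg_ex; exists p => N Np.
have [//|UN] := in_ultra_setVsetC (x @^-1` N) UU.
by have [q [nNq Nq]] := cp (~` N) N UN Np.
Qed.

Section LimsupNull.
Variables (R : realType) (phi : R -> R) (a r : R).
Hypothesis W : weight phi a r.
Local Notation mu := (@lebesgue_measure R).
Local Notation C := (r * a / (1 - r)).
Local Notation X := (inCM0 phi).
Implicit Types (f g h : R -> R) (A B : set R) (t x P c M e s : R).

Let phi_gt0 := weight_gt0 W.

Definition limsup_band M (E : nat -> set R) : set R :=
  \bigcap_m \bigcup_(n in [set n | (m <= n)%N]) (E n `&` band M).

Lemma measurable_limsup_band M E : (forall n, measurable (E n)) ->
  measurable (limsup_band M E).
Proof.
move=> mE; apply: bigcapT_measurable => m; apply: bigcup_measurable => n _.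
exact: measurable_Iband.
Qed.

(** B is the countable union of its intersections with the [E k], k > n, which cannot all be
    null. *)
Lemma nonnull_step M E B n : (forall n, measurable (E n)) -> measurable B ->
  B `<=` limsup_band M E -> mu B <> 0%E ->
  exists n', (n < n')%N /\ mu (B `&` E n') <> 0%E.
Proof.
move=> mE mB BL muB; apply: contra_notP muB => /forallNP H.
have mBE k : measurable (B `&` E k) by exact: measurableI.
have -> : B = \bigcup_k (B `&` E (n.+1 + k)%N).
  apply/seteqP; split => x; last by move=> [k _ []].
  move=> Bx; have [i /= ni [Ex _]] := BL x Bx n.+1 I.
  by exists (i - n.+1)%N => //; rewrite subnKC.
apply: measure_negligible.
  by apply: bigcupT_measurable => k; exact: mBE.
apply: negligible_bigcup => k; apply/negligibleP; first exact: mBE.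
by apply: contrapT => h; apply: (H (n.+1 + k)%N); split => //; rewrite leq_addr.
Qed.

(** Iterates [nonnull_step]. The measures of the [B j] stay positive but may tend to 0, which is why
    averages over these sets are taken afterwards. *)
Lemma nonnull_chain M E : (forall n, measurable (E n)) ->
  mu (limsup_band M E) <> 0%E ->
  exists (k : nat -> nat) (B : nat -> set R), [/\ forall j, (j <= k j)%N,
    forall j, measurable (B j) /\ mu (B j) <> 0%E,
    forall j, B j `<=` band M & forall i j, (i <= j)%N -> B j `<=` E (k i)].
Proof.
move=> mE muL; pose L := limsup_band M E.
pose good (z : nat * set R) := [/\ measurable z.2, z.2 `<=` L & mu z.2 <> 0%E].
have step (z : {z | good z}) : exists z' : {z | good z},
    [/\ ((sval z).1 < (sval z').1)%N, (sval z').2 `<=` (sval z).2 &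
        (sval z').2 `<=` E (sval z').1].
  case: z => [[n B] /= [mB BL muB]].
  have [n' [nn' muB']] := nonnull_step n mE mB BL muB.
  have g : good (n', B `&` E n').
    by split => //=; [exact: measurableI|exact: subset_trans (@subIsetl _ _ _) BL].
  by exists (exist _ (n', B `&` E n') g); split => //= x [].
have [F HF] := choice step.
have g0 : good (0%N, L) by split => //; exact: measurable_limsup_band.
pose z j := iter j.+1 F (exist _ (0%N, L) g0).
have zS j : z j.+1 = F (z j) by [].
exists (fun j => (sval (z j)).1), (fun j => (sval (z j)).2).
have zd i j : (i <= j)%N -> (sval (z j)).2 `<=` (sval (z i)).2.
  elim: j => [|j IH]; first by rewrite leqn0 => /eqP ->.
  rewrite leq_eqVlt => /predU1P[->//|/IH h].
  by apply: subset_trans h; rewrite zS; have [_ + _] := HF (z j).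
split.
- elim=> [//|j IH]; rewrite zS; have [+ _ _] := HF (z j).
  exact: leq_ltn_trans.
- by move=> j; have [mB _ muB] := svalP (z j).
- move=> j x; have [_ BL _] := svalP (z j) => /BL /(_ 0%N I)[n _ []].
  by [].
- move=> i j ij; apply: subset_trans (zd i j ij) _.
  by rewrite /z iterS; have [_ _] := HF (iter i F (exist _ (0%N, L) g0)).
Qed.

(* If the sets E n met infinitely often on a non-null set, the ultrafilter limit
   of normalized indicators along a nested sequence of non-null intersections
   would be an element of the bidual not tending to 0 on v. *)
Lemma limsup_level_null (v : nat -> (R -> R) -> R) M e s (E : nat -> set R) :
  weak0dual phi v -> 0 < M -> 0 < e -> (forall n, measurable (E n)) ->
  (forall n A, measurable A -> A `<=` E n ->
     e * bmeas M A <= s * v n (cut A (bunit M))) ->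
  mu (limsup_band M E) = 0%E.
Proof.
move=> v0 M0 e0 mE HE; apply: contrapT => muL.
have [k [B [kj mB BQ BE]]] := nonnull_chain mE muL.
have [U [UU Uoo]] := @ultraFilterLemma nat \oo _.
have Xe := inCM0_bunit W M0.
have bB j : 0 < bmeas M (B j).
  have [mBj muB] := mB j; rewrite lt_neqAle bmeas_ge0 andbT eq_sym.
  apply/eqP => h; apply: muB; rewrite -(setIidl (BQ j)).
  by rewrite -[LHS]fineK ?[fine _]h// fin_bmeas.
(* A bound, the same for all j, for the norm of the indicator of [B j] divided by its measure; it
   makes the averages [y w] bounded along j. *)
pose c := C * (phi M^-1 * M).
pose y (w : (R -> R) -> R) j := w (cut (B j) (bunit M)) / bmeas M (B j).
have yb w j : dualX phi w -> `|y w j| <= c * fine (dualnorm phi w).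
  move=> Hw; have [mBj _] := mB j.
  rewrite /y normrM [X in _ * X]ger0_norm ?invr_ge0 ?bmeas_ge0// ler_pdivrMr//.
  have P0 : 0 < phi M^-1 * M * bmeas M (B j).
    by rewrite !mulr_gt0// phi_gt0// invr_gt0.
  have := dual_le_dualnorm W Hw (inCM0_cut W Xe mBj) (bunit_prim_bound W M0 mBj) P0.
  move=> /le_trans; apply; rewrite le_eqVlt; apply/orP; left; apply/eqP.
  by rewrite /c; ring.
have cy w : dualX phi w -> y w @ U --> lim (y w @ U).
  by move=> Hw; apply: (@bounded_ultra_cvg R U _ (c * fine (dualnorm phi w))) => // j; exact: yb.
pose Phi w := lim (y w @ U).
have bPhi : bidualX phi Phi.
  split.
    move=> b w w' Hw Hw'; apply/cvg_lim => //.
    have -> : y (fun f => b * w f + w' f) = (fun j => b * y w j + y w' j).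
      by apply/funext => j; rewrite /y mulrDl mulrA.
    by apply: cvgD; [apply: cvgMr; exact: cy|exact: cy].
  exists c => w Hw; rewrite -[dualnorm _ _]fineK ?(dualnorm_fin W)// -EFinM lee_fin.
  have cn : (fun j => `|y w j|) @ U --> `|Phi w| by apply: cvg_norm; exact: cy.
  rewrite -(cvg_lim _ cn)//; apply: limr_le; first by apply/cvg_ex; eexists; exact: cn.
  by apply: nearW => j; exact: yb.
(* For i >= j the set [B i] lies in [E (k j)], so the i-th average times s is at least e; the
   ultrafilter contains these tails. *)
have Phi_ge j : e <= s * Phi (v (k j)).
  have Hw := v0.1 (k j).
  have cn : (fun i => s * y (v (k j)) i) @ U --> s * Phi (v (k j)).
    by apply: cvgMr; exact: cy.
  rewrite -(cvg_lim _ cn)//; apply: limr_ge; first by apply/cvg_ex; eexists; exact: cn.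
  apply: Uoo; exists j => // i /= ji; have [mBi _] := mB i.
  by rewrite /y mulrA ler_pdivlMr//; apply: HE => //; exact: BE.
have := v0.2 _ bPhi => h.
have s1 : 0 < `|s| + 1 by rewrite ltr_wpDl.
have [N HN] := cvg0_eventually h (divr_gt0 e0 (mulr_gt0 (ltr0Sn R 1) s1)).
have := HN (k N) (kj N); have := Phi_ge N; set p := Phi _ => h1 h2.
have : e <= `|s| * (e / (2 * (`|s| + 1))).
  apply: le_trans h1 _; apply: le_trans (ler_norm _) _; rewrite normrM.
  by rewrite ler_wpM2l.
rewrite mulrA ler_pdivlMr ?mulr_gt0// [X in _ <= X]mulrC ler_pM2l// leNgt => /negP; apply.
by rewrite mulr_natl mulr2n ltr_pwDl// lerDl.
Qed.

End LimsupNull.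

(** * Assembly of the three smallness statements *)

Section DunfordPettis.
Variables (R : realType) (phi : R -> R) (a r : R).
Hypothesis W : weight phi a r.
Local Notation mu := (@lebesgue_measure R).
Local Notation X := (inCM0 phi).

Let phi_gt0 := weight_gt0 W.

Let third_split (d x y z : R) : x <= d / 3 -> y <= d / 3 -> z <= d / 3 ->
  x + y + z <= d.
Proof. by move=> *; lra. Qed.

(** [E n] joins the Hahn sets of [v n] and of [-1 * v n] at level e, that is, the places where the
    density of [v n] is at least e in absolute value. The upper limit of a union is covered by the
    two upper limits, both null. *)
Lemma dual_level_sets (v : nat -> (R -> R) -> R) (M e : R) :
  weak0dual phi v -> 0 < M -> 0 < e ->
  exists E : nat -> set R, [/\ forall n, measurable (E n),
    mu (limsup_band M E) = 0%E &
    forall n f, X f ->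
      `|v n (cut (~` E n `&` band M) f)| <= 2 * e * L1 mu (band M) f].
Proof.
move=> v0 M0 e0; have Xv := v0.1.
have [P HP] := choice (fun n => hahn_level W e (Xv n) M0).
have [P' HP'] := choice (fun n => hahn_level W e (dual_scale (-1) (Xv n)) M0).
have mP n : measurable (P n) by have [] := HP n.
have mP' n : measurable (P' n) by have [] := HP' n.
have mE n : measurable (P n `|` P' n) by exact: measurableU.
exists (fun n => P n `|` P' n); split => //.
- have null1 : mu (limsup_band M P) = 0%E.
    apply: (limsup_level_null W (s := 1) v0 M0 e0 mP) => n A mA AP.
    by rewrite mul1r; have [_ + _] := HP n; apply.
  have null2 : mu (limsup_band M P') = 0%E.
    apply: (limsup_level_null W (s := -1) v0 M0 e0 mP') => n A mA AP.
    by have [_ + _] := HP' n; apply.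
  have mL1 := measurable_limsup_band M mP.
  have mL2 := measurable_limsup_band M mP'.
  apply/eqP; rewrite eq_le measure_ge0 andbT.
  apply: (@le_trans _ _ (mu (limsup_band M P `|` limsup_band M P'))).
    apply: le_lebesgue_measure; first exact: measurable_limsup_band.
      exact: measurableU.
    move=> x Hx; have [|nx] := pselect (limsup_band M P x); first by left.
    right=> m _; move/existsNP : nx => [m0 /not_implyP[_ nx]].
    have [n /= hn [[Px|Px] Qx]] := Hx (maxn m m0) I; move: hn; rewrite geq_max => /andP[mn m0n].
      by exfalso; apply: nx; exists n.
    by exists n.
  apply: le_trans (measureU2 _ _ _) _ => //.
  rewrite -[leRHS]adde0; by apply: leeD; rewrite le_eqVlt; apply/orP; left; apply/eqP.
- move=> n f Xf; apply: (level_abs W (Xv n) M0 (ltW e0)) => //.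
  + exact: measurableC.
  + move=> A mA AE; have [_ _ H] := HP n; apply: H => // x Ax Px.
    by apply: (AE x Ax); left.
  + move=> A mA AE; have [_ _ H] := HP' n; apply: H => // x Ax Px.
    by apply: (AE x Ax); right.
Qed.

Lemma weight_DunfordPettis : DunfordPettis_CM0 phi.
Proof.
move=> u v u0 v0; have Xu := u0.1; have Xv := v0.1.
have [b Hb] := weak0X_bounded W u0; have b0 := prim_bound_ge0 W (Hb 0%N).
have [V V0 HV] := weak0dual_bounded W v0.
have b1 : 0 < b + 1 by rewrite ltr_wpDl.
apply: eventually_cvg0 => d d0; have d3 : 0 < d / 3 by rewrite divr_gt0.
have [M M1 Htail] := weak0dual_tails W v0 (divr_gt0 d3 b1).
have M0 : 0 < M := lt_trans ltr01 M1.
have mQ : measurable (band M) by exact: measurable_band.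
have mQC := measurableC mQ.
have QI : band M `<=` I0 M by exact: band_I0.
have tail n : `|v n (cut (~` band M) (u n))| <= d / 3.
  (* The tail estimate concerns functions of bound 1; dividing by b + 1 also covers the case b =
     0. *)
  pose g x := (b + 1)^-1 * u n x; have Xg : X g by exact: (inCM0_scale W).
  have gb : prim_bound phi g 1.
    have := prim_bound_scale W (b + 1)^-1 (Xu n) (Hb n); apply: prim_boundW.
    rewrite ger0_norm ?invr_ge0 ?(ltW b1)// ler_pdivrMl// mulr1.
    by rewrite lerDl.
  have := Htail n g Xg gb; rewrite (_ : cut _ g =
      (fun x => (b + 1)^-1 * cut (~` band M) (u n) x)); last first.
    by apply/funext => x; rewrite /cut /g mulrA.
  rewrite (dualZ W (b + 1)^-1 (Xv n) (inCM0_cut W (Xu n) mQC)) normrM.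
  by rewrite ger0_norm ?invr_ge0 ?(ltW b1)// [leRHS]mulrC ler_pM2l ?invr_gt0.
pose Lb := (b + 1) * M / phi M.
have Lb0 : 0 < Lb by rewrite divr_gt0 ?mulr_gt0 ?phi_gt0.
have uL n : L1 mu (band M) (u n) <= Lb.
  apply: le_trans (L1_le_prim W mQ M0 QI (Xu n)) _.
  rewrite ler_pdivlMr ?phi_gt0// mulrC.
  by apply: le_trans (Hb n M M0) _; rewrite ler_pM2r// lerDl.
(* The level is chosen so that 2 e Lb = d / 3. *)
have e0 : 0 < d / 3 / (2 * Lb) by rewrite divr_gt0// mulr_gt0.
have [E [mE muE HE]] := dual_level_sets v0 M0 e0.
(* [F m] contains the exceptional sets of all [v n] with n >= m at once, and its intersection over m
   is [limsup_band M E]. *)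
pose F m := \bigcup_(n in [set n | (m <= n)%N]) (E n `&` band M).
have mF m : measurable (F m).
  by apply: bigcup_measurable => n _; exact: measurable_Iband.
have FQ m : F m `<=` band M by move=> x [n _ []].
have FI m : F m `<=` I0 M by apply: subset_trans (FQ m) QI.
have Fd m : F m.+1 `<=` F m.
  by move=> x [n /= mn Ex]; exists n => //=; exact: ltnW.
pose c := phi M^-1 * M.
have c0 : 0 <= c by rewrite mulr_ge0 ?(ltW M0)// ltW// phi_gt0// invr_gt0.
have Vc1 : 0 < V * c + 1 by rewrite ltr_wpDl// mulr_ge0.
have [m Hm] := weak0X_equiintegrable W u0 M0 mF FI Fd muE (divr_gt0 d3 Vc1).
exists m => n mn.
have mFC := measurableC (mF m).
rewrite (dual_split W (Xv n) (Xu n) mQ).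
rewrite (dual_split W (Xv n) (inCM0_cut W (Xu n) mQ) (mF m)).
apply: le_trans (ler_normD _ _) _; apply: le_trans (lerD (ler_normD _ _) (lexx _)) _.
apply: third_split => //.
  rewrite cutI (setIidl (FQ m)).
  have XF := inCM0_cut W (Xu n) (mF m).
  apply: le_trans (HV n _ _ XF (band_prim_bound W (Xu n) M0 (mF m) (FQ m))) _.
  rewrite -/c mulrA; apply: (@le_trans _ _ (V * c * (d / 3 / (V * c + 1)))).
    by apply: ler_wpM2l; [exact: mulr_ge0|exact: Hm].
  by rewrite mulrA ler_pdivrMr// mulrC ler_pM2l// lerDl.
(* Since n >= m, leaving out [F m] also leaves out [E n] within the band, so the level estimate for
   [v n] applies. *)
have -> : cut (~` F m) (cut (band M) (u n)) =
    cut (~` E n `&` band M) (cut (~` F m) (u n)).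
  rewrite !cutI; congr (cut _ _); apply/seteqP; split => x.
    by move=> [nF Qx]; split => //; split => // Ex; apply: nF; exists n.
  by move=> [[_ Qx] nF].
have XC := inCM0_cut W (Xu n) mFC.
apply: le_trans (HE n _ XC) _.
apply: (@le_trans _ _ (2 * (d / 3 / (2 * Lb)) * Lb)).
  apply: ler_wpM2l; first by rewrite mulr_ge0 ?(ltW e0).
  apply: le_trans (uL n).
  apply: (@L1_mono _ _ R mu) => //.
  - apply: measurable_fun_Dom (inCM0_measurable W XC) => //.
    by apply: subset_trans QI _; exact: I0_Dom.
  - by move=> x _; exact: norm_cut_le.
  - exact: (inCM0_integrable W (Xu n) mQ M0 QI).
by rewrite le_eqVlt; apply/orP; left; apply/eqP; field; rewrite gt_eqF.
Qed.

End DunfordPettis.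

Theorem theorem9 (R : realType) (phi : R -> R) :
  phi 0 = 0 ->
  (forall t, 0 < t -> 0 < phi t) ->
  {in (@Dom R) &, {homo phi : x y / x <= y}} ->
  (forall x y (l : R), 0 <= x -> 0 <= y -> 0 <= l <= 1 ->
     (1 - l) * phi x + l * phi y <= phi ((1 - l) * x + l * y)) ->
  phi x @[x --> 0^'+] --> 0 ->
  upper_index_lt1 phi ->
  DunfordPettis_CM0 phi.
Proof.
move=> phi00 phi_gt0 phi_homo phi_concave phi_cvg0 phi_index.
have [a [r W]] := weight_exists phi00 phi_gt0 phi_homo phi_concave phi_cvg0 phi_index.
exact: weight_DunfordPettis W.
Qed.
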